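(* Let $\{\psi_{b,n}\}_{b\in\mathbb{R},\,n=n_m,\ldots,n_M}$ be an empirical wavelet system generated by $\psi\in L^1(\mathbb{R})\cap L^2(\mathbb{R})$, and let $\widehat{\psi}_n=T_{\omega_n}D_{a_n}\widehat{\psi}$. Assume that $$0<\sum_{n=n_m}^{n_M}\left|\widehat{\psi}_n(\xi)\right|^2<\infty\quad\text{a.e.},$$ and define the set of dual empirical wavelets $\{\phi_n\}_{n=n_m}^{n_M}$ by $$\forall\xi\in\mathbb{R},\quad \widehat{\phi}_n(\xi)=\frac{\widehat{\psi}_n(\xi)}{\sum_{m=n_m}^{n_M}\left|\widehat{\psi}_m(\xi)\right|^2}.$$ Then, for $f\in L^1(\mathbb{R})\cap L^2(\mathbb{R})$ (all functions being considered to belong to $L^1(\mathbb{R})\cap L^2(\mathbb{R})$), $$f(t)=\sum_{n=n_m}^{n_M}\left(\mathcal{E}_\psi^f(\cdot,n)\star\phi_n\right)(t).$$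
   Context: Standing convention: all functions are considered to belong to $L^1(\mathbb{R})\cap L^2(\mathbb{R})$, with inner product $\langle f,g\rangle=\int_{\mathbb{R}}f(t)\overline{g(t)}\,dt$. Fourier transform: $\hat f(\xi)=\int_{\mathbb{R}}f(t)e^{-2\pi\imath\xi t}dt$, with inverse $f(t)=\int_{\mathbb{R}}\hat f(\xi)e^{2\pi\imath\xi t}d\xi$. Operators: $E_af(t)=e^{2\pi\imath at}f(t)$, $T_af(t)=f(t-a)$, and, for $a>0$, $D_af(t)=\frac{1}{\sqrt a}f(t/a)$. The symbol $\star$ denotes convolution, $(g\star h)(t)=\int_{\mathbb{R}}g(s)h(t-s)\,ds$. The frequency line is partitioned by an increasing set of boundary points $\nu_n$ into supports $\Omega_n=[\nu_n,\nu_{n+1}]$, with index $n$ running over $n_m,\ldots,n_M$ (finitely many supports, or infinitely many when $n_m=-\infty$ and $n_M=+\infty$). The convention is $\nu_0=0$; alternatively the boundary $\nu_0$ may be left out, in which case $n\neq 0$ and $\Omega_{-1}=[\nu_{-1},\nu_1]$. No support has length zero, and none has infinite length except possibly a leftmost and/or a rightmost ray. The center of a compact support is its midpoint $\omega_n$. The center of a ray is the point of the ray at distance from its finite endpoint equal to half the length of the adjacent compact support. To each support is attached a scaling factor $a_n>0$, whose choice depends on $\psi$ and is made so that $T_{\omega_n}D_{a_n}\widehat\psi$ is mostly localized on $\Omega_n$. Given $\psi\in L^1(\mathbb{R})\cap L^2(\mathbb{R})$ whose Fourier transform is localized around the zero frequency, the empirical wavelet system generated by $\psi$ is the family $\psi_{b,n}=T_bE_{\omega_n}D_{1/a_n}\psi$,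 equivalently $\widehat{\psi}_{b,n}=E_{-b}T_{\omega_n}D_{a_n}\widehat\psi$. One writes $\widehat\psi_n=T_{\omega_n}D_{a_n}\widehat\psi$, so $\widehat\psi_{b,n}=E_{-b}\widehat\psi_n$. The continuous empirical wavelet transform of $f$ is $\mathcal{E}_\psi^f(b,n)=\langle f,T_bE_{\omega_n}D_{1/a_n}\psi\rangle=\langle \widehat f,E_{-b}T_{\omega_n}D_{a_n}\widehat\psi\rangle$. In $\mathcal{E}_\psi^f(\cdot,n)\star\phi_n$ the convolution is in the variable $b$. *)

(* Defs.v *)
From HB Require Import structures.
From mathcomp Require Import all_boot all_order all_algebra finmap.
From mathcomp Require Import all_classical all_reals all_analysis.
From mathcomp Require Import complex.

Set Implicit Arguments.
Unset Strict Implicit.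
Unset Printing Implicit Defensive.
Import Order.TTheory GRing.Theory Num.Theory.
Import numFieldNormedType.Exports.

Local Open Scope classical_set_scope.
Local Open Scope ring_scope.

Notation normc := ComplexField.Normc.normc.

Section ComplexValuedFunctions.
Variable R : realType.
Local Notation mu := (@lebesgue_measure R).
Implicit Types (f g : R -> R[i]) (a t xi : R).

Definition cintegral f : R[i] :=
  ((\int[mu]_t complex.Re (f t))%R +i* (\int[mu]_t complex.Im (f t))%R)%C.

Definition in_Lp (p : \bar R) f : Prop :=
  [/\ measurable_fun setT (fun t => complex.Re (f t)),
      measurable_fun setT (fun t => complex.Im (f t)) &
      (Lnorm mu p (fun t => (normc (f t))%:E) < +oo)%E].

Definition in_L1L2 f : Prop := in_Lp 1%E f /\ in_Lp 2%:E f.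

Definition inner f g : R[i] := cintegral (fun t => f t * (g t)^*).

Definition convolution f g t : R[i] := cintegral (fun s => f s * g (t - s)).

(* e^(i x) *)
Definition expi (x : R) : R[i] := (cos x +i* sin x)%C.

Definition fourier f xi : R[i] :=
  cintegral (fun t => f t * expi (- (2 * pi * xi * t))).

Definition modulation a f t : R[i] := expi (2 * pi * a * t) * f t.
Definition translation a f t : R[i] := f (t - a).
Definition dilation a f t : R[i] := ((Num.sqrt a)^-1)%:C%C * f (t / a).

End ComplexValuedFunctions.

Section Summation.

(* The finite subsets of I directed by inclusion: convergence along this
   filter is unconditional summability. *)
Definition finite_subsets (I : choiceType) : set_system {fset I} :=
  filter_from setT (fun A : {fset I} => [set B : {fset I} | (A `<=` B)%fset]).
Arguments finite_subsets I : clear implicits.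

#[global] Instance finite_subsets_filter (I : choiceType) :
  ProperFilter (finite_subsets I).
Proof.
apply: filter_from_proper => [|A _]; last by exists A => /=.
apply: filter_from_filter; first by exists fset0.
move=> A B _ _; exists (A `|` B)%fset => // C /= sC.
by split; apply: fsubset_trans sC; rewrite ?fsubsetUl ?fsubsetUr.
Qed.

Variable R : realType.

Definition has_sum (J : set int) (z : int -> R[i]) (w : R[i]) : Prop :=
  (normc (w - \sum_(n <- A | n \in J) z n) : R)
    @[A --> finite_subsets int] --> (0 : R).

Definition has_L2_sum (J : set int) (g : int -> R -> R[i]) (f : R -> R[i]) :
    Prop :=
  Lnorm (@lebesgue_measure R) 2%:E
    (fun t => (normc (f t - \sum_(n <- A | n \in J) g n t))%:E)
    @[A --> finite_subsets int] --> (0 : \bar R)%E.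

End Summation.

Section Partition.
Variable R : realType.

(* Indices n with nmin <= n <= nmax, minus 0 when the boundary of index 0 is
   left out. *)
Definition index_set (nmin nmax : \bar int) (skip0 : bool) : set int :=
  [set n | (nmin <= n%:E <= nmax)%E /\ (skip0 -> n <> 0)].

Definition next_index (skip0 : bool) (n : int) : int :=
  if skip0 && (n == -1) then 1 else n + 1.

Definition prev_index (skip0 : bool) (n : int) : int :=
  if skip0 && (n == 1) then -1 else n - 1.

Definition support_of (skip0 : bool) (nu : int -> \bar R) (n : int) : set R :=
  [set x | (nu n <= x%:E <= nu (next_index skip0 n))%E].

Definition compact_support (nmin nmax : \bar int) (skip0 : bool)
    (nu : int -> \bar R) (n : int) : Prop :=
  [/\ index_set nmin nmax skip0 n, nu n \is a fin_num &
      nu (next_index skip0 n) \is a fin_num].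

(* Only the values of nu at the endpoints of the supports matter. Since these
   strictly increase, nu can be infinite only at the left end of a leftmost
   support or at the right end of a rightmost one. The last two fields are what
   the definition of the center of a ray presupposes. *)
Record freq_partition := FreqPartition {
  nmin : \bar int;
  nmax : \bar int;
  skip0 : bool;
  nu : int -> \bar R;
  nu_increasing : forall n, index_set nmin nmax skip0 n ->
    (nu n < nu (next_index skip0 n))%E;
  nu_cover : \bigcup_(n in index_set nmin nmax skip0) support_of skip0 nu n
    = setT;
  nu_zero : ~~ skip0 -> nu 0 = 0%E /\
    exists2 n, index_set nmin nmax skip0 n & n = 0 \/ next_index skip0 n = 0;
  nu_skip_zero : skip0 -> index_set nmin nmax skip0 (-1);
  nu_left_ray : forall n, index_set nmin nmax skip0 n -> nu n = -oo%E ->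
    compact_support nmin nmax skip0 nu (next_index skip0 n);
  nu_right_ray : forall n, index_set nmin nmax skip0 n ->
    nu (next_index skip0 n) = +oo%E ->
    compact_support nmin nmax skip0 nu (prev_index skip0 n) }.

Definition indices (P : freq_partition) : set int :=
  index_set (nmin P) (nmax P) (skip0 P).

Definition support_center (P : freq_partition) (n : int) : R :=
  let next := next_index (skip0 P) in
  let prev := prev_index (skip0 P) in
  match nu P n, nu P (next n) with
  | c%:E, d%:E => (c + d) / 2
  | -oo%E, d%:E => d - (fine (nu P (next (next n))) - d) / 2
  | c%:E, +oo%E => c + (c - fine (nu P (prev n))) / 2
  | _, _ => 0
  end.

End Partition.

Section EmpiricalWavelets.
Variables (R : realType) (P : freq_partition R) (a : int -> R).
Variable psi : R -> R[i].

Definition empirical_wavelet (b : R) (n : int) : R -> R[i] :=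
  translation b (modulation (support_center P n) (dilation (a n)^-1 psi)).

Definition wavelet_hat (n : int) : R -> R[i] :=
  translation (support_center P n) (dilation (a n) (fourier psi)).

Definition wavelet_energy (xi : R) : \bar R :=
  \esum_(n in indices P) ((normc (wavelet_hat n xi)) ^+ 2)%:E.

Definition empirical_transform (f : R -> R[i]) (b : R) (n : int) : R[i] :=
  inner f (empirical_wavelet b n).

End EmpiricalWavelets.

(* Main.v *)
Require Import Defs.
From HB Require Import structures.
From mathcomp Require Import all_boot all_order all_algebra finmap.
From mathcomp Require Import all_classical all_reals all_analysis.
From mathcomp Require Import measurable_realfun complex.
From mathcomp Require Import ring lra.

Set Implicit Arguments.
Unset Strict Implicit.
Unset Printing Implicit Defensive.
Import Order.TTheory GRing.Theory Num.Theory.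
Import numFieldNormedType.Exports.

Local Open Scope classical_set_scope.
Local Open Scope ring_scope.

(* In the frequency domain, E_psi^f(., n) * phi_n is multiplication of the
   Fourier transform of f by |psi_n^|^2 / sum_m |psi_m^|^2, and these weights sum
   to 1 almost everywhere; so the error of a finite partial sum has Fourier
   transform f^ (1 - sum of the weights), which tends to 0 in L^2 (and in L^1 when
   f^ is integrable) by dominated convergence.

   To go back to the time domain it is enough to know, for h in L^1, that
   ||h||_2 <= ||h^||_2 and that |h| <= ||h^||_1 almost everywhere.  Both come from
   Abel summation: damping h^ by exp(-2 pi |x| / N) amounts to convolving h with
   the Poisson kernel.  The Schur test for that kernel yields ||h^||_2 <= ||h||_2.
   Applied on the frequency side, it controls the Poisson means of h, which
   converge everywhere once h is replaced by its averages over intervals of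
   length 2r (bounded continuous functions); Fatou's lemma and Lebesgue's
   differentiation theorem then remove the two regularizations. *)

(** Both norm bounds are statements about a single integrable function whose right-hand sides may be
    infinite, so the L2 Fourier transform and its extension by density never enter. They apply to
    the error itself: convolutions of integrable functions are integrable, hence so is [f] minus a
    finite partial sum, and its transform is a genuine integral. What fails is plain inversion,
    because that transform need not be integrable; the Abel factor repairs this. The exponential
    serves as damping because its transform comes from an elementary antiderivative and is a
    positive kernel of mass one. Averaging precedes the Poisson means because averages of an
    integrable function are bounded and continuous, which is what dominated convergence against a
    kernel with long tails asks for. Averaging also does not increase the modulus of the transform,
    so all bounds stay uniform in [r]. Finally, sums run along the directed set of finite index
    sets, which is not a sequence; an exhaustion of the indices and the monotonicity of the weights
    bridge the gap to dominated convergence. *)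

Section NormC.
Variable R : realType.
Implicit Types z w : R[i].

Lemma normc_def_sqrt z : normc z = Num.sqrt (complex.Re z ^+ 2 + complex.Im z ^+ 2).
Proof. by case: z. Qed.

Lemma normc_ge0 z : 0 <= normc z.
Proof. by rewrite normc_def_sqrt sqrtr_ge0. Qed.

Lemma normc_sqr z : normc z ^+ 2 = complex.Re z ^+ 2 + complex.Im z ^+ 2.
Proof. by rewrite normc_def_sqrt sqr_sqrtr// addr_ge0 ?sqr_ge0. Qed.

Lemma normcM z w : normc (z * w) = normc z * normc w.
Proof. exact: ComplexField.Normc.normcM. Qed.

Lemma normc0 : normc (0 : R[i]) = 0.
Proof. exact: ComplexField.Normc.normc0. Qed.

Lemma Re_mul z w : complex.Re (z * w) =
  complex.Re z * complex.Re w - complex.Im z * complex.Im w.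
Proof. by case: z w => a b [c d]. Qed.

Lemma Im_mul z w : complex.Im (z * w) =
  complex.Re z * complex.Im w + complex.Im z * complex.Re w.
Proof. by case: z w => a b [c d]. Qed.

Lemma Re_add z w : complex.Re (z + w) = complex.Re z + complex.Re w.
Proof. by case: z w => a b [c d]. Qed.

Lemma Im_add z w : complex.Im (z + w) = complex.Im z + complex.Im w.
Proof. by case: z w => a b [c d]. Qed.

Lemma conjcE z : z^* = (complex.Re z -i* complex.Im z)%C.
Proof. by case: z. Qed.

Lemma normc_conj z : normc z^* = normc z.
Proof. by rewrite !normc_def_sqrt conjcE /= sqrrN. Qed.

Lemma conjcR (x : R) : (x%:C%C)^* = x%:C%C.
Proof. by rewrite conjcE /= oppr0. Qed.

Lemma normcR (x : R) : normc x%:C%C = `|x|.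
Proof. by rewrite normc_def_sqrt/= expr0n/= addr0 sqrtr_sqr. Qed.

Lemma normc_le_ReIm z : normc z <= `|complex.Re z| + `|complex.Im z|.
Proof.
rewrite -(ler_pXn2r (n := 2)) ?nnegrE ?addr_ge0 ?normc_ge0//.
rewrite normc_sqr sqrrD !real_normK ?num_real//.
by rewrite addrAC lerDl mulrn_wge0// mulr_ge0.
Qed.

Lemma Re_le_normc z : `|complex.Re z| <= normc z.
Proof.
rewrite -(ler_pXn2r (n := 2)) ?nnegrE ?normc_ge0//.
by rewrite normc_sqr real_normK ?num_real// lerDl sqr_ge0.
Qed.

Lemma Im_le_normc z : `|complex.Im z| <= normc z.
Proof.
rewrite -(ler_pXn2r (n := 2)) ?nnegrE ?normc_ge0//.
by rewrite normc_sqr real_normK ?num_real// lerDr sqr_ge0.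
Qed.

Lemma mulcJ z : z * z^* = ((normc z) ^+ 2)%:C%C.
Proof. by rewrite normc_sqr conjcE; case: z => a b /=; congr Complex => /=; ring. Qed.

Lemma eqc z w : complex.Re z = complex.Re w -> complex.Im z = complex.Im w -> z = w.
Proof. by case: z w => a b [c d] /= -> ->. Qed.

Lemma expiD (x y : R) : expi (x + y) = expi x * expi y.
Proof. by apply: eqc; rewrite /= ?sinD ?cosD//; ring. Qed.

Lemma expiN (x : R) : expi (- x) = (expi x)^*.
Proof. by rewrite conjcE /expi cosN sinN. Qed.

Lemma normc_expi (x : R) : normc (expi x) = 1.
Proof. by rewrite normc_def_sqrt /= cos2Dsin2 sqrtr1. Qed.

End NormC.

(** * Measurability of complex-valued functions *)

Section CMeasurable.
Context {R : realType} d (T : measurableType d).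
Implicit Types (f g : T -> R[i]).

(** Componentwise, to match [in_Lp]; the domain is kept general so that the notion also covers
    integrands on [R * R]. *)
Definition cmeasurable f : Prop :=
  measurable_fun setT (fun t => complex.Re (f t)) /\
  measurable_fun setT (fun t => complex.Im (f t)).

Lemma cmeasurableD f g : cmeasurable f -> cmeasurable g ->
  cmeasurable (fun t => f t + g t).
Proof.
move=> [f1 f2] [g1 g2]; split.
  by under eq_fun do rewrite Re_add; exact: measurable_funD.
by under eq_fun do rewrite Im_add; exact: measurable_funD.
Qed.

Lemma cmeasurableM f g : cmeasurable f -> cmeasurable g ->
  cmeasurable (fun t => f t * g t).
Proof.
move=> [f1 f2] [g1 g2]; split.
  by under eq_fun do rewrite Re_mul; apply: measurable_funB; exact: measurable_funM.
by under eq_fun do rewrite Im_mul; apply: measurable_funD; exact: measurable_funM.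
Qed.

Lemma cmeasurable_cst (c : R[i]) : cmeasurable (fun=> c).
Proof. by split; exact: measurable_cst. Qed.

Lemma cmeasurableJ f : cmeasurable f -> cmeasurable (fun t => (f t)^*).
Proof.
move=> [f1 f2]; split.
  by under eq_fun do rewrite conjcE/=.
by under eq_fun do rewrite conjcE/=; exact: measurable_funN.
Qed.

Lemma cmeasurableR (u : T -> R) : measurable_fun setT u ->
  cmeasurable (fun t => (u t)%:C%C).
Proof. by move=> mu; split => //=; exact: measurable_cst. Qed.

Lemma cmeasurable_expi (u : T -> R) : measurable_fun setT u ->
  cmeasurable (fun t => expi (u t)).
Proof.
by move=> mu; split => /=; apply: measurableT_comp => //;
  apply: continuous_measurable_fun; [exact: continuous_cos|exact: continuous_sin].
Qed.

Lemma measurable_normc f : cmeasurable f ->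
  measurable_fun setT (fun t => normc (f t)).
Proof.
move=> [f1 f2]; under eq_fun do rewrite normc_def_sqrt.
apply: (measurableT_comp (f := @Num.sqrt R)) => //.
  by apply: continuous_measurable_fun; exact: sqrt_continuous.
by apply: measurable_funD; exact: measurable_funX.
Qed.

Lemma measurable_normcE f : cmeasurable f ->
  measurable_fun setT (fun t => (normc (f t))%:E).
Proof. by move=> mf; exact/measurable_EFinP/measurable_normc. Qed.

End CMeasurable.

Lemma cmeasurable_comp {R : realType} d d' (T : measurableType d)
    (T' : measurableType d') (f : T' -> R[i]) (p : T -> T') :
  cmeasurable f -> measurable_fun setT p -> cmeasurable (fun t => f (p t)).
Proof.
move=> [f1 f2] mp; split; first exact: (measurableT_comp f1 mp).
exact: (measurableT_comp f2 mp).
Qed.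

(** * Integrals of complex-valued functions *)

Section CIntegral.
Variable R : realType.
Local Notation mu := (@lebesgue_measure R).
Implicit Types (f g : R -> R[i]).

Lemma ae_mono (P Q : R -> Prop) : (forall t, P t -> Q t) ->
  {ae mu, forall t, P t} -> {ae mu, forall t, Q t}.
Proof. exact: (@filterS _ _ (ae_filter_ringOfSetsType mu)). Qed.

Lemma ae_and (P Q : R -> Prop) : {ae mu, forall t, P t} ->
  {ae mu, forall t, Q t} -> {ae mu, forall t, P t /\ Q t}.
Proof. exact: (@filterI _ _ (ae_filter_ringOfSetsType mu)). Qed.

Definition cintegrable f : Prop :=
  cmeasurable f /\ (\int[mu]_t (normc (f t))%:E < +oo)%E.

Lemma in_Lp1P f : in_Lp 1%E f <-> cintegrable f.
Proof.
have e : Lnorm mu 1%E (fun t => (normc (f t))%:E) = (\int[mu]_t (normc (f t))%:E)%E.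
  rewrite Lnorm1; apply: eq_integral => x _.
  by rewrite gee0_abs// lee_fin normc_ge0.
by split=> [[? ? ?]|[[? ?] ?]]; split; rewrite -?e// ?e.
Qed.

Lemma integral_normc_ge0 f : (0 <= \int[mu]_t (normc (f t))%:E)%E.
Proof. by apply: integral_ge0 => t _; rewrite lee_fin normc_ge0. Qed.

Lemma le_cintegrable f (h : R -> \bar R) : cmeasurable f ->
  measurable_fun setT h ->
  (forall t, ((normc (f t))%:E <= h t)%E) -> (\int[mu]_t h t < +oo)%E ->
  cintegrable f.
Proof.
move=> mf mh fh hoo; split => //; apply: le_lt_trans hoo.
apply: ge0_le_integral => //; last exact: measurable_normcE.
by move=> t _; rewrite lee_fin normc_ge0.
Qed.

Lemma cintegrable_dom f g : cmeasurable f -> cintegrable g ->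
  (forall t, normc (f t) <= normc (g t)) -> cintegrable f.
Proof.
move=> mf [mg goo] fg; apply: (@le_cintegrable f (fun t => (normc (g t))%:E)) => //.
by apply: measurable_normcE.
Qed.

Lemma cintegrable_Re f : cintegrable f ->
  mu.-integrable setT (EFin \o (fun t => complex.Re (f t))).
Proof.
move=> [mf foo]; apply/integrableP; split; first by apply/measurable_EFinP; apply: mf.1.
apply: le_lt_trans foo; apply: ge0_le_integral => //=.
- by apply/measurable_EFinP; apply: measurableT_comp => //; apply: mf.1.
- exact: measurable_normcE.
- by move=> t _; rewrite lee_fin Re_le_normc.
Qed.

Lemma cintegrable_Im f : cintegrable f ->
  mu.-integrable setT (EFin \o (fun t => complex.Im (f t))).
Proof.
move=> [mf foo]; apply/integrableP; split; first by apply/measurable_EFinP; apply: mf.2.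
apply: le_lt_trans foo; apply: ge0_le_integral => //=.
- by apply/measurable_EFinP; apply: measurableT_comp => //; apply: mf.2.
- exact: measurable_normcE.
- by move=> t _; rewrite lee_fin Im_le_normc.
Qed.

Lemma cintegrableD f g : cintegrable f -> cintegrable g ->
  cintegrable (fun t => f t + g t).
Proof.
move=> [mf foo] [mg goo].
have mf' := measurable_normcE mf; have mg' := measurable_normcE mg.
apply: (@le_cintegrable _ (fun t => (normc (f t))%:E + (normc (g t))%:E)%E).
- exact: cmeasurableD.
- exact: emeasurable_funD.
- by move=> t; rewrite -EFinD lee_fin le_normcD.
- rewrite ge0_integralD//; last first.
  + by move=> t _; rewrite lee_fin normc_ge0.
  + by move=> t _; rewrite lee_fin normc_ge0.
  by rewrite lte_add_pinfty.
Qed.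

Lemma cintegrableZ (c : R[i]) f : cintegrable f -> cintegrable (fun t => c * f t).
Proof.
move=> [mf foo]; split; first by apply: cmeasurableM => //; exact: cmeasurable_cst.
under eq_integral do rewrite normcM EFinM.
rewrite ge0_integralZl_EFin ?normc_ge0//.
- by rewrite lte_mul_pinfty// lee_fin normc_ge0.
- by move=> t _; rewrite lee_fin normc_ge0.
- exact: measurable_normcE.
Qed.

Lemma cintegrableJ f : cintegrable f -> cintegrable (fun t => (f t)^*).
Proof.
move=> [mf foo]; split; first exact: cmeasurableJ.
by under eq_integral do rewrite normc_conj.
Qed.

Lemma cintegrableMexpi f (u : R -> R) : measurable_fun setT u ->
  cintegrable f -> cintegrable (fun t => f t * expi (u t)).
Proof.
move=> mu' fi; apply: (cintegrable_dom _ fi) => [|t].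
  by apply: cmeasurableM; [exact: fi.1|exact: cmeasurable_expi].
by rewrite normcM normc_expi mulr1.
Qed.

Lemma cintegrable_sum (I : Type) (r : seq I) (P : pred I) (h : I -> R -> R[i]) :
  (forall i, P i -> cintegrable (h i)) ->
  cintegrable (fun t => \sum_(i <- r | P i) h i t).
Proof.
move=> mh; elim: r => [|i r IH].
  under eq_fun do rewrite big_nil; split; first exact: cmeasurable_cst.
  by under eq_integral do rewrite normc0; rewrite integral0.
have [Pi|Pi] := boolP (P i); last first.
  by under eq_fun do rewrite big_cons (negbTE Pi).
under eq_fun do rewrite big_cons Pi.
by apply: cintegrableD => //; exact: mh.
Qed.

Lemma eq_cintegral f g : f =1 g -> cintegral f = cintegral g.
Proof. by move=> /funext ->. Qed.

Lemma cintegralD f g : cintegrable f -> cintegrable g ->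
  cintegral (fun t => f t + g t) = cintegral f + cintegral g.
Proof.
move=> fi gi; apply: eqc; rewrite /cintegral /=.
  rewrite -RintegralD//; try exact: cintegrable_Re.
  by congr Rintegral; apply/funext => t; rewrite Re_add.
rewrite -RintegralD//; try exact: cintegrable_Im.
by congr Rintegral; apply/funext => t; rewrite Im_add.
Qed.

Lemma cintegralZ (c : R[i]) f : cintegrable f ->
  cintegral (fun t => c * f t) = c * cintegral f.
Proof.
move=> fi; have fr := cintegrable_Re fi; have fI := cintegrable_Im fi.
have h (a : R) (u : R -> R) : mu.-integrable setT (EFin \o u) ->
    mu.-integrable setT (EFin \o (fun t => a * u t)).
  by move=> iu; apply: eq_integrable (integrableZl _ a iu).
apply: eqc; rewrite /cintegral /=.
  rewrite [RHS]Re_mul /= -!RintegralZl// -RintegralB//; try exact: h.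
  by congr Rintegral; apply/funext => t; rewrite Re_mul.
rewrite [RHS]Im_mul /= -!RintegralZl// -RintegralD//; try exact: h.
by congr Rintegral; apply/funext => t; rewrite Im_mul.
Qed.

Lemma cintegralJ f : cintegrable f ->
  cintegral (fun t => (f t)^*) = (cintegral f)^*.
Proof.
move=> fi; apply: eqc; rewrite conjcE /cintegral /=.
  by congr Rintegral; apply/funext => t; rewrite conjcE.
rewrite -mulN1r -RintegralZl//; last exact: cintegrable_Im.
by congr Rintegral; apply/funext => t; rewrite conjcE /= mulN1r.
Qed.

Lemma cintegral_sum (I : eqType) (r : seq I) (P : pred I) (h : I -> R -> R[i]) :
  (forall i, P i -> cintegrable (h i)) ->
  cintegral (fun t => \sum_(i <- r | P i) h i t) =
  \sum_(i <- r | P i) cintegral (h i).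
Proof.
move=> mh; elim: r => [|i r IH].
  under eq_cintegral do rewrite big_nil.
  by rewrite big_nil /cintegral/= Rintegral_cst// mul0r.
have [Pi|Pi] := boolP (P i); rewrite big_cons ?Pi ?(negbTE Pi); last first.
  by under eq_cintegral do rewrite big_cons (negbTE Pi).
under eq_cintegral do rewrite big_cons Pi.
by rewrite cintegralD ?IH//; [exact: mh|exact: cintegrable_sum].
Qed.

Lemma ae_eq_cintegral f g : cmeasurable f -> cmeasurable g ->
  {ae mu, forall t, f t = g t} -> cintegral f = cintegral g.
Proof.
move=> mf mg fg; apply: eqc; congr fine; apply: ae_eq_integral => //=.
- by apply/measurable_EFinP; apply: mf.1.
- by apply/measurable_EFinP; apply: mg.1.
- by apply: (ae_mono _ fg) => t /= ->.
- by apply/measurable_EFinP; apply: mf.2.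
- by apply/measurable_EFinP; apply: mg.2.
- by apply: (ae_mono _ fg) => t /= ->.
Qed.

(** Rotation trick: with [z] the integral, |z|^2 is the real part of the integral of [z^* * f t],
    hence at most |z| times the integral of |f|, and a nonzero |z| cancels. Bounding the two
    components separately would lose a constant. For a non-integrable [f] the right side is
    [+oo]. *)
Lemma le_normc_cintegral f : cmeasurable f ->
  ((normc (cintegral f))%:E <= \int[mu]_t (normc (f t))%:E)%E.
Proof.
move=> mf; have [foo|] := ltP (\int[mu]_t (normc (f t))%:E)%E +oo%E; last first.
  by rewrite leye_eq => /eqP ->; rewrite leey.
have fi : cintegrable f by [].
set z := cintegral f.
have [z0|z0] := eqVneq (normc z) 0; first by rewrite z0 integral_normc_ge0.
have zp : 0 < normc z by rewrite lt_neqAle eq_sym z0 normc_ge0.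
rewrite -(@lee_pmul2l _ (normc z)%:E)// -EFinM -expr2.
have -> : normc z ^+ 2 = \int[mu]_t complex.Re (z^* * f t).
  transitivity (complex.Re (cintegral (fun t => z^* * f t))); last by [].
  by rewrite cintegralZ// mulrC mulcJ.
have zfi : cintegrable (fun t => z^* * f t) by exact: cintegrableZ.
rewrite /Rintegral fineK; last exact/integrable_fin_num/cintegrable_Re.
rewrite -ge0_integralZl_EFin ?normc_ge0//; last 2 first.
- by move=> t _; rewrite lee_fin normc_ge0.
- exact: measurable_normcE.
apply: (le_trans (lee_abs _)).
apply: (le_trans (le_abse_integral _ _ _)) => //.
  by apply/measurable_EFinP; apply: zfi.1.1.
apply: ge0_le_integral => //=.
- by apply/measurable_EFinP; apply: measurableT_comp => //; exact: zfi.1.1.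
- by apply: emeasurable_funM => //; exact: measurable_normcE.
- move=> t _; rewrite -EFinM lee_fin; apply: le_trans (Re_le_normc _) _.
  by rewrite normcM normc_conj.
Qed.

Lemma normc_cintegral_le f : cintegrable f ->
  normc (cintegral f) <= fine (\int[mu]_t (normc (f t))%:E)%E.
Proof.
move=> [mf foo]; rewrite -lee_fin fineK ?le_normc_cintegral//.
by rewrite ge0_fin_numE// integral_normc_ge0.
Qed.

End CIntegral.

(** * Fubini for real and complex integrands *)

Section Fubini.
Variable R : realType.
Local Notation mu := (@lebesgue_measure R).

(** No integrability enters: the inner integral is the difference of those of the positive and
    negative parts, each measurable in [x] by Tonelli, and [fine] sends infinite values to a
    default. *)
Lemma measurable_Rintegral1 (h : R * R -> R) : measurable_fun setT h ->
  measurable_fun setT (fun x => \int[mu]_y h (x, y)).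
Proof.
move=> mh; apply: (measurableT_comp (f := fine)) => //.
have mE : measurable_fun setT (EFin \o h) by exact/measurable_EFinP.
rewrite (_ : (fun x => _) = (fun x => (\int[mu]_y ((EFin \o h)^\+ (x, y)))%E -
    (\int[mu]_y ((EFin \o h)^\- (x, y)))%E)%E); last first.
  apply/funext => x; rewrite integralE; congr (_ - _)%E; apply: eq_integral => y _.
    by rewrite !funeposE.
  by rewrite !funenegE.
apply: emeasurable_funB.
- apply: (measurable_fun_fubini_tonelli_F (m2 := mu) (EFin \o h)^\+%E) => //.
  exact: measurable_funepos.
- apply: (measurable_fun_fubini_tonelli_F (m2 := mu) (EFin \o h)^\-%E) => //.
  exact: measurable_funeneg.
Qed.

Lemma cmeasurable_cintegral1 (F : R * R -> R[i]) : cmeasurable F ->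
  cmeasurable (fun x => cintegral (fun y => F (x, y))).
Proof.
move=> [F1 F2]; split; first exact: (measurable_Rintegral1 F1).
exact: (measurable_Rintegral1 F2).
Qed.

Lemma RFubini (h : R * R -> R) : measurable_fun setT h ->
  (\int[mu]_x \int[mu]_y `|(h (x, y))%:E| < +oo)%E ->
  \int[mu]_x (\int[mu]_y h (x, y)) = \int[mu]_y (\int[mu]_x h (x, y)).
Proof.
move=> mh hoo.
have mE : measurable_fun setT (EFin \o h) by exact/measurable_EFinP.
have ih : (mu \x mu)%E.-integrable setT (EFin \o h).
  by apply/integrable12ltyP.
(* The inner real integrals are truncated by [fine]; since an integrable function is finite almost
   everywhere, the truncation changes the integrand on a null set only. *)
have fini (u : R -> \bar R) : mu.-integrable setT u ->
    (\int[mu]_x (fine (u x))%:E = \int[mu]_x u x)%E.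
  move=> iu; have mu_ := measurable_int _ iu.
  apply: ae_eq_integral => //.
    by apply/measurable_EFinP; apply: (measurableT_comp (f := fine)).
  by apply: (ae_mono _ (integrable_ae measurableT iu)) => x /= ux _; rewrite fineK// ux.
rewrite /Rintegral; congr fine.
rewrite (fini _ (integrable_fubini_F ih)).
rewrite (Fubini ih) -(fini (fun y => \int[mu]_x (EFin \o h) (x, y))%E)//.
apply/integrableP; split; first exact: (measurable_fubini_G ih).
have := hoo; rewrite (fubini_tonelli (m1 := mu) (m2 := mu) (abse \o (EFin \o h)))//=; last first.
  exact: measurableT_comp.
apply: le_lt_trans; apply: ge0_le_integral => //=.
- by apply: measurableT_comp => //; exact: (measurable_fubini_G ih).
- apply: (measurable_fun_fubini_tonelli_G (m1 := mu) (abse \o (EFin \o h))) => //=.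
  exact: measurableT_comp.
- move=> y _; apply: le_abse_integral => //.
  exact: (measurableT_comp mE (pair2_measurable y)).
Qed.

Lemma cFubini (F : R * R -> R[i]) : cmeasurable F ->
  (\int[mu]_x \int[mu]_y (normc (F (x, y)))%:E < +oo)%E ->
  cintegral (fun x => cintegral (fun y => F (x, y))) =
  cintegral (fun y => cintegral (fun x => F (x, y))).
Proof.
move=> mF Foo.
have mN := measurable_normcE mF.
have h (u : R * R -> R) : measurable_fun setT u ->
    (forall z, `|u z| <= normc (F z)) ->
    (\int[mu]_x \int[mu]_y `|(u (x, y))%:E| < +oo)%E.
  move=> mu_ uF; apply: le_lt_trans Foo; apply: ge0_le_integral => //=.
  - by move=> x _; exact: integral_ge0.
  - apply: (measurable_fun_fubini_tonelli_F (m2 := mu) (abse \o (EFin \o u))) => //=.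
    by apply: measurableT_comp => //; exact/measurable_EFinP.
  - apply: (measurable_fun_fubini_tonelli_F (m2 := mu) (fun z => (normc (F z))%:E)) => //.
    by move=> z; rewrite lee_fin normc_ge0.
  - move=> x _; apply: ge0_le_integral => //=.
    + apply/measurable_EFinP; apply: measurableT_comp => //.
      exact: (measurableT_comp mu_ (pair1_measurable x)).
    + exact: (measurableT_comp mN (pair1_measurable x)).
    + by move=> y _; rewrite lee_fin.
apply: eqc.
  apply: (RFubini (h := fun z => complex.Re (F z))) mF.1 _; apply: h mF.1 _ => z.
  exact: Re_le_normc.
apply: (RFubini (h := fun z => complex.Im (F z))) mF.2 _; apply: h mF.2 _ => z.
exact: Im_le_normc.
Qed.

End Fubini.

(** * Affine changes of variable *)

Section Affine.
Variable R : realType.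
Local Notation mu := (@lebesgue_measure R).

(** Uniqueness of Lebesgue measure: the pushforward under the affine map, scaled by [|al|], gives
    every interval []c, d]] its length. For negative [al] the preimage is closed on the left and
    open on the right, which does not affect its length; hence the two cases. *)
Lemma lebesgue_measure_affine (al b : R) (A : set R) : al != 0 -> measurable A ->
  (mu A = `|al|%:E * mu ((fun x : R => al * x + b)%R @^-1` A))%E.
Proof.
move=> al0 mA.
pose phi : measurableTypeR R -> measurableTypeR R := fun x : R => al * x + b.
have mphi : measurable_fun setT phi.
  apply: (@continuous_measurable_fun R phi) => x.
  by apply: cvgD; [apply: cvgM; [exact: cvg_cst|exact: cvg_id]|exact: cvg_cst].
pose nu := mscale (NngNum (normr_ge0 al)) (pushforward mu phi).
transitivity (nu mphi A); last by [].
apply: (lebesgue_measure_unique (mu := nu mphi)) => // _ [[c d] /= _ <-].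
rewrite /nu /mscale /= /pushforward lebesgue_measure_itv/=.
have [al_lt0|al_gt0|/eqP] := ltgtP al 0; last by rewrite (negbTE al0).
  have -> : phi @^-1` `]c, d] = `[(d - b) / al, (c - b) / al[%classic.
    apply/seteqP; split=> x /=; rewrite !in_itv/= /phi/= => /andP[h1 h2];
      apply/andP; split.
    - by rewrite ler_ndivrMr// lerBrDr mulrC.
    - by rewrite ltr_ndivlMr// ltrBlDr mulrC.
    - by move: h2; rewrite ltr_ndivlMr// ltrBlDr mulrC.
    - by move: h1; rewrite ler_ndivrMr// lerBrDr mulrC.
  rewrite lebesgue_measure_itv/= !lte_fin ltr_nM2r ?invr_lt0// ltrBDr subrK.
  case: ifPn => cd; last by rewrite mule0.
  rewrite ltr0_norm// -!EFinB -EFinM; congr EFin; field; exact: al0.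
have -> : phi @^-1` `]c, d] = `](c - b) / al, (d - b) / al]%classic.
  apply/seteqP; split=> x /=; rewrite !in_itv/= /phi/= => /andP[h1 h2];
    apply/andP; split.
  - by rewrite ltr_pdivrMr// ltrBlDr mulrC.
  - by rewrite ler_pdivlMr// lerBrDr mulrC.
  - by move: h1; rewrite ltr_pdivrMr// ltrBlDr mulrC.
  - by move: h2; rewrite ler_pdivlMr// lerBrDr mulrC.
rewrite lebesgue_measure_itv/= !lte_fin ltr_pM2r ?invr_gt0// ltrBDr subrK.
case: ifPn => cd; last by rewrite mule0.
rewrite gtr0_norm// -!EFinB -EFinM; congr EFin; field; exact: al0.
Qed.

Lemma measurable_affine (al b : R) : measurable_fun setT (fun x : R => al * x + b).
Proof.
apply: continuous_measurable_fun => x.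
by apply: cvgD; [apply: cvgM; [exact: cvg_cst|exact: cvg_id]|exact: cvg_cst].
Qed.

Lemma ge0_integral_affine (al b : R) (h : R -> \bar R) : al != 0 ->
  measurable_fun setT h -> (forall x, 0 <= h x)%E ->
  (`|al|%:E * \int[mu]_x h (al * x + b)%R = \int[mu]_x h x)%E.
Proof.
move=> al0 mh h0.
pose phi : measurableTypeR R -> measurableTypeR R := fun x : R => al * x + b.
have mphi : measurable_fun setT phi := measurable_affine al b.
have := ge0_integral_pushforward mphi mu (D := setT) measurableT mh.
rewrite preimage_setT => <-; last by move=> x _; exact: h0.
rewrite [X in (X%:E * _)%E](_ : `|al| = (NngNum (normr_ge0 al))%:num)//.
rewrite -ge0_integral_mscale//.
apply: eq_measure_integral => A mA _; apply/esym.
exact: (lebesgue_measure_affine b al0 mA).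
Qed.

Lemma cintegral_affine (al b : R) (f : R -> R[i]) : al != 0 -> cintegrable f ->
  cintegral (fun x => f (al * x + b)) = (`|al|^-1)%:C%C * cintegral f.
Proof.
move=> al0 [mf foo].
have h (u : R -> R) : measurable_fun setT u -> mu.-integrable setT (EFin \o u) ->
    \int[mu]_x u (al * x + b) = `|al|^-1 * \int[mu]_x u x.
  move=> mu_ iu; have al0' : `|al| != 0 by rewrite normr_eq0.
  have mE : measurable_fun setT (EFin \o u) by exact/measurable_EFinP.
  rewrite /Rintegral [in LHS]integralE [in RHS]integralE.
  have e (v : R -> \bar R) : measurable_fun setT v -> (forall x, 0 <= v x)%E ->
      (\int[mu]_x v (al * x + b)%R = (`|al|^-1)%:E * \int[mu]_x v x)%E.
    move=> mv v0; rewrite -(ge0_integral_affine b al0 mv v0) muleA -EFinM.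
    by rewrite mulVf// mul1e.
  have -> : (\int[mu]_x (fun x => (u (al * x + b))%:E)^\+ x =
      (`|al|^-1)%:E * \int[mu]_x (EFin \o u)^\+ x)%E.
    rewrite -e; [|exact: measurable_funepos|by move=> x; exact: funepos_ge0].
    by apply: eq_integral => x _; rewrite !funeposE.
  have -> : (\int[mu]_x (fun x => (u (al * x + b))%:E)^\- x =
      (`|al|^-1)%:E * \int[mu]_x (EFin \o u)^\- x)%E.
    rewrite -e; [|exact: measurable_funeneg|by move=> x; exact: funeneg_ge0].
    by apply: eq_integral => x _; rewrite !funenegE.
  have fn := integrable_neg_fin_num measurableT iu.
  have fp := integrable_pos_fin_num measurableT iu.
  rewrite -muleBr//; last by rewrite fin_num_adde_defl// fin_numN.
  by rewrite fineM// fin_numB fn fp.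
have fi : cintegrable f by [].
apply: eqc; rewrite ?Re_mul ?Im_mul /= mul0r ?subr0 ?addr0.
  by rewrite -(h _ mf.1)//; exact: cintegrable_Re.
by rewrite -(h _ mf.2)//; exact: cintegrable_Im.
Qed.

Lemma cintegrable_affine (al b : R) (f : R -> R[i]) : al != 0 -> cintegrable f ->
  cintegrable (fun x => f (al * x + b)).
Proof.
move=> al0 [mf foo]; split; first exact: (cmeasurable_comp mf (measurable_affine al b)).
rewrite -(@lte_pmul2l _ `|al|%:E)// ?lte_fin ?normr_gt0//.
rewrite (ge0_integral_affine b al0 (measurable_normcE mf)).
  by rewrite gt0_muley// lte_fin normr_gt0.
by move=> x; rewrite lee_fin normc_ge0.
Qed.
End Affine.

Section ShiftFlip.
Variable R : realType.
Local Notation mu := (@lebesgue_measure R).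

Lemma ge0_integral_shift (s : R) (h : R -> \bar R) :
  measurable_fun setT h -> (forall x, 0 <= h x)%E ->
  (\int[mu]_t h (t - s)%R = \int[mu]_t h t)%E.
Proof.
move=> mh h0; rewrite -(ge0_integral_affine (- s) (oner_neq0 _) mh h0).
by rewrite normr1 mul1e; apply: eq_integral => t _; rewrite mul1r.
Qed.

Lemma ge0_integral_flip (s : R) (h : R -> \bar R) :
  measurable_fun setT h -> (forall x, 0 <= h x)%E ->
  (\int[mu]_t h (s - t)%R = \int[mu]_t h t)%E.
Proof.
have N1 : (-1 : R) != 0 by rewrite oppr_eq0 oner_neq0.
move=> mh h0; rewrite -(ge0_integral_affine s N1 mh h0).
rewrite normrN1 mul1e; apply: eq_integral => t _.
by rewrite mulN1r addrC.
Qed.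

Lemma cintegral_shift (s : R) (f : R -> R[i]) : cintegrable f ->
  cintegral (fun t => f (t - s)) = cintegral f.
Proof.
move=> fi; have := cintegral_affine (- s) (oner_neq0 _) fi.
rewrite normr1 invr1 mul1r => <-.
by apply: eq_cintegral => t; rewrite mul1r.
Qed.

Lemma cintegral_flip (s : R) (f : R -> R[i]) : cintegrable f ->
  cintegral (fun t => f (s - t)) = cintegral f.
Proof.
have N1 : (-1 : R) != 0 by rewrite oppr_eq0 oner_neq0.
move=> fi; have := cintegral_affine s N1 fi.
rewrite normrN1 invr1 mul1r => <-.
by apply: eq_cintegral => t; rewrite mulN1r addrC.
Qed.

Lemma cintegrable_flip (s : R) (f : R -> R[i]) : cintegrable f ->
  cintegrable (fun t => f (s - t)).
Proof.
have N1 : (-1 : R) != 0 by rewrite oppr_eq0 oner_neq0.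
move=> fi; have := cintegrable_affine s N1 fi.
by under eq_fun do rewrite mulN1r addrC.
Qed.

End ShiftFlip.

(** * Fourier transform, convolution and the multiplication formula *)

Section Fourier.
Variable R : realType.
Local Notation mu := (@lebesgue_measure R).
Implicit Types (f g u v : R -> R[i]).

Lemma measurable_phase (x : R) : measurable_fun setT (fun t : R => - (2 * pi * x * t)).
Proof.
have := measurable_affine (- (2 * pi * x)) 0.
by under eq_fun do rewrite addr0 mulNr.
Qed.

Lemma measurable_phase2 :
  measurable_fun setT (fun z : R * R => - (2 * pi * z.1 * z.2)).
Proof.
apply: measurable_funN; apply: measurable_funM; last exact: measurable_snd.
by apply: measurable_funM; [exact: measurable_cst|exact: measurable_fst].
Qed.

Lemma cintegrable_fourier f (x : R) : cintegrable f ->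
  cintegrable (fun t => f t * expi (- (2 * pi * x * t))).
Proof. by move=> fi; apply: cintegrableMexpi => //; exact: measurable_phase. Qed.

Lemma cmeasurable_fourier f : cmeasurable f -> cmeasurable (fourier f).
Proof.
move=> mf; apply: (@cmeasurable_cintegral1 R
  (fun z : R * R => f z.2 * expi (- (2 * pi * z.1 * z.2)))).
apply: cmeasurableM; first exact: (cmeasurable_comp mf measurable_snd).
exact: (cmeasurable_expi measurable_phase2).
Qed.

Lemma normc_fourier f (x : R) : cintegrable f ->
  normc (fourier f x) <= fine (\int[mu]_t (normc (f t))%:E)%E.
Proof.
move=> fi; apply: le_trans (normc_cintegral_le (cintegrable_fourier x fi)) _.
by under eq_integral do rewrite normcM normc_expi mulr1.
Qed.

Lemma fourierD f g (x : R) : cintegrable f -> cintegrable g ->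
  fourier (fun t => f t + g t) x = fourier f x + fourier g x.
Proof.
move=> fi gi; rewrite /fourier -cintegralD; try exact: cintegrable_fourier.
by apply: eq_cintegral => t; rewrite mulrDl.
Qed.

Lemma fourierZ (c : R[i]) f (x : R) : cintegrable f ->
  fourier (fun t => c * f t) x = c * fourier f x.
Proof.
move=> fi; rewrite /fourier -cintegralZ; last exact: cintegrable_fourier.
by apply: eq_cintegral => t; rewrite mulrA.
Qed.

Lemma fourier_sum (I : eqType) (r : seq I) (P : pred I) (h : I -> R -> R[i]) x :
  (forall i, P i -> cintegrable (h i)) ->
  fourier (fun t => \sum_(i <- r | P i) h i t) x =
  \sum_(i <- r | P i) fourier (h i) x.
Proof.
move=> hi; rewrite /fourier -cintegral_sum; last first.
  by move=> i Pi; apply: cintegrable_fourier; exact: hi.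
by apply: eq_cintegral => t; rewrite big_distrl.
Qed.

(** The inner products of [f] with the translates of a function form the convolution of [f] with the
    conjugate reflection of that function; this rule turns them into a product of transforms. It
    also shows that an even real function has a real transform. *)
Lemma fourier_flipJ f (x : R) : cintegrable f ->
  fourier (fun t => (f (- t))^*) x = (fourier f x)^*.
Proof.
move=> fi; rewrite -cintegralJ; last exact: cintegrable_fourier.
rewrite -(cintegral_flip 0); last exact/cintegrableJ/cintegrable_fourier.
apply: eq_cintegral => t; rewrite sub0r rmorphM; congr (_ * _).
by rewrite (_ : - _ = - - (2 * pi * x * - t)) ?mulrN ?opprK//; exact: expiN.
Qed.

Lemma fourier_modulation (a : R) f (x : R) :
  fourier (modulation a f) x = fourier f (x - a).
Proof.
apply: eq_cintegral => t; rewrite /modulation mulrAC mulrC -expiD.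
by congr (_ * expi _); ring.
Qed.

Lemma fourier_dilation (a : R) f (x : R) : 0 < a -> cintegrable f ->
  fourier (dilation a^-1 f) x = dilation a (fourier f) x.
Proof.
move=> a0 fi; rewrite /dilation /fourier.
have fx := cintegrable_fourier (x / a) fi.
have an0 : a != 0 by rewrite gt_eqF.
transitivity (cintegral (fun t => ((Num.sqrt a^-1)^-1)%:C%C *
    (fun s => f s * expi (- (2 * pi * (x / a) * s))) (a * t + 0))).
  apply: eq_cintegral => t; rewrite addr0 invrK [t * a]mulrC [RHS]mulrA.
  by congr (_ * expi _); field.
rewrite cintegralZ; last exact: (cintegrable_affine 0 an0 fx).
rewrite (cintegral_affine 0 an0 fx) mulrA; congr (_ * _).
rewrite -rmorphM; congr (_%:C)%C; rewrite sqrtrV ?ltW// invrK gtr0_norm//.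
rewrite -{2}(sqr_sqrtr (ltW a0)) expr2 invfM mulrA divff ?mul1r//.
by rewrite gt_eqF// sqrtr_gt0.
Qed.

(** Multiplication formula: Fubini applies because the double integrand has modulus |u(y)| |v(x)|,
    the phase being of modulus one. It moves a transform from the function onto the damping
    factor. *)
Lemma fourier_swap u v : cintegrable u -> cintegrable v ->
  cintegral (fun x => fourier u x * v x) = cintegral (fun x => u x * fourier v x).
Proof.
move=> ui vi.
pose F (z : R * R) := u z.2 * expi (- (2 * pi * z.1 * z.2)) * v z.1.
have mF : cmeasurable F.
  apply: cmeasurableM; last exact: (cmeasurable_comp vi.1 measurable_fst).
  apply: cmeasurableM; first exact: (cmeasurable_comp ui.1 measurable_snd).
  exact: (cmeasurable_expi measurable_phase2).
transitivity (cintegral (fun x => cintegral (fun y => F (x, y)))).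
  apply: eq_cintegral => x; rewrite mulrC -cintegralZ; last exact: cintegrable_fourier.
  by apply: eq_cintegral => t; rewrite mulrC.
rewrite cFubini//.
  apply: eq_cintegral => y; rewrite -cintegralZ; last exact: cintegrable_fourier.
  apply: eq_cintegral => t; rewrite /F/= -mulrA [expi _ * _]mulrC; congr (_ * (_ * expi _)).
  by ring.
under eq_integral do under eq_integral do rewrite /F !normcM normc_expi mulr1 mulrC EFinM/=.
under eq_integral => x _.
  rewrite ge0_integralZl_EFin ?normc_ge0//; last 2 first.
  - by move=> t _; rewrite lee_fin normc_ge0.
  - by apply: measurable_normcE; exact: ui.1.
  over.
have ufin : (\int[mu]_t (normc (u t))%:E)%E \is a fin_num.
  by rewrite ge0_fin_numE ?integral_normc_ge0//; exact: ui.2.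
rewrite -(fineK ufin); under eq_integral do rewrite muleC.
rewrite ge0_integralZl_EFin//.
- by rewrite lte_mul_pinfty// ?lee_fin ?fine_ge0 ?integral_normc_ge0//; exact: vi.2.
- by move=> t _; rewrite lee_fin normc_ge0.
- by apply: measurable_normcE; exact: vi.1.
- by rewrite fine_ge0// integral_normc_ge0.
Qed.

Let cF f g (z : R * R) := f z.2 * g (z.1 - z.2).

Let mcF f g : cmeasurable f -> cmeasurable g -> cmeasurable (cF f g).
Proof.
move=> mf mg; apply: cmeasurableM; first exact: (cmeasurable_comp mf measurable_snd).
apply: (cmeasurable_comp mg).
by apply: measurable_funB; [exact: measurable_fst|exact: measurable_snd].
Qed.

Let cF_tonelli f g : cmeasurable f -> cmeasurable g ->
  (\int[mu]_x \int[mu]_y (normc (cF f g (x, y)))%:E =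
   (\int[mu]_t (normc (f t))%:E) * (\int[mu]_t (normc (g t))%:E))%E.
Proof.
move=> mf mg.
transitivity (\int[mu]_y \int[mu]_x (normc (cF f g (x, y)))%:E)%E.
  apply: (fubini_tonelli (m1 := mu) (m2 := mu) (fun z => (normc (cF f g z))%:E)).
    by apply: measurable_normcE; exact: mcF.
  by move=> z; rewrite lee_fin normc_ge0.
under eq_integral => y _.
  under eq_integral do rewrite normcM /= EFinM.
  have mgy : cmeasurable (fun x : R => g (x - y)).
    apply: (cmeasurable_comp mg); have := measurable_affine 1 (- y).
    by under eq_fun do rewrite mul1r.
  rewrite ge0_integralZl_EFin ?normc_ge0//; last 2 first.
  - by move=> t _; rewrite lee_fin normc_ge0.
  - exact: measurable_normcE.
  rewrite (ge0_integral_shift y (h := fun t => (normc (g t))%:E)); last 2 first.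
  - exact: measurable_normcE.
  - by move=> t; rewrite lee_fin normc_ge0.
  over.
rewrite ge0_integralZr//.
- exact: measurable_normcE.
- by move=> t _; rewrite lee_fin normc_ge0.
- exact: integral_normc_ge0.
Qed.

Lemma integral_convolution_le f g : cmeasurable f -> cmeasurable g ->
  (\int[mu]_t (normc (convolution f g t))%:E <=
   (\int[mu]_t (normc (f t))%:E) * (\int[mu]_t (normc (g t))%:E))%E.
Proof.
move=> mf mg; rewrite -cF_tonelli//; apply: ge0_le_integral => //.
- by move=> t _; rewrite lee_fin normc_ge0.
- by apply: measurable_normcE; apply: (@cmeasurable_cintegral1 R (cF f g)); exact: mcF.
- apply: (measurable_fun_fubini_tonelli_F (m2 := mu) (fun z => (normc (cF f g z))%:E)).
  + by apply: measurable_normcE; exact: mcF.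
  + by move=> z; rewrite lee_fin normc_ge0.
- move=> t _; apply: le_normc_cintegral.
  exact: (cmeasurable_comp (mcF mf mg) (pair1_measurable t)).
Qed.

Lemma cintegrable_convolution f g : cintegrable f -> cintegrable g ->
  cintegrable (convolution f g).
Proof.
move=> [mf foo] [mg goo]; split.
  by apply: (@cmeasurable_cintegral1 R (cF f g)); exact: mcF.
apply: le_lt_trans (integral_convolution_le mf mg) _.
by rewrite lte_mul_pinfty ?integral_normc_ge0// ge0_fin_numE// integral_normc_ge0.
Qed.

Lemma fourier_convolution f g (x : R) : cintegrable f -> cintegrable g ->
  fourier (convolution f g) x = fourier f x * fourier g x.
Proof.
move=> fi gi; have [mf foo] := fi; have [mg goo] := gi.
have mc := mcF mf mg.
pose G (z : R * R) := cF f g z * expi (- (2 * pi * x * z.1)).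
have mG : cmeasurable G.
  apply: cmeasurableM => //; apply: cmeasurable_expi.
  exact: (measurableT_comp (measurable_phase x) measurable_fst).
have Goo : (\int[mu]_t \int[mu]_s (normc (cF f g (t, s)))%:E < +oo)%E.
  rewrite cF_tonelli//.
  by rewrite lte_mul_pinfty ?integral_normc_ge0// ge0_fin_numE// integral_normc_ge0.
transitivity (cintegral (fun t => cintegral (fun s => G (t, s)))).
  (* For a given [t] the function [s |-> f s * g (t - s)] may fail to be integrable, so the phase
     can be taken under the inner integral only for almost every [t]. *)
  apply: ae_eq_cintegral.
  - apply: cmeasurableM; first exact: (@cmeasurable_cintegral1 R (cF f g)).
    exact: (cmeasurable_expi (measurable_phase x)).
  - exact: (@cmeasurable_cintegral1 R G).
  have mI : measurable_fun setT (fun t => \int[mu]_s (normc (cF f g (t, s)))%:E)%E.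
    apply: (measurable_fun_fubini_tonelli_F (m2 := mu) (fun z => (normc (cF f g z))%:E)).
      exact: measurable_normcE.
    by move=> z; rewrite lee_fin normc_ge0.
  have iI : mu.-integrable setT (fun t => \int[mu]_s (normc (cF f g (t, s)))%:E)%E.
    apply/integrableP; split => //; under eq_integral do rewrite gee0_abs ?integral_normc_ge0//.
    exact: Goo.
  apply: (ae_mono _ (integrable_ae measurableT iI)) => t /= /(_ I) tfin.
  have Fi : cintegrable (fun s => cF f g (t, s)).
    split; first exact: (cmeasurable_comp mc (pair1_measurable t)).
    by rewrite -ge0_fin_numE// integral_normc_ge0.
  rewrite mulrC -cintegralZ//.
  by apply: eq_cintegral => s; rewrite mulrC.
rewrite cFubini//; last first.
  by under eq_integral do under eq_integral do rewrite normcM normc_expi mulr1.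
rewrite mulrC -cintegralZ; last exact: cintegrable_fourier.
apply: eq_cintegral => s.
rewrite mulrC -cintegralZ; last exact: cintegrable_fourier.
rewrite -[RHS](cintegral_shift s); last exact/cintegrableZ/cintegrable_fourier.
apply: eq_cintegral => t; rewrite /G /cF /= -!mulrA; congr (_ * _).
by rewrite [RHS]mulrCA -expiD; congr (_ * expi _); ring.
Qed.

End Fourier.

(** * The Poisson kernel *)

Section Poisson.
Variable R : realType.
Local Notation mu := (@lebesgue_measure R).

(** Adding 1 to the cosine keeps the integrand nonnegative, as the fundamental theorem of calculus
    on a half-line used here requires. The antiderivative [F] is that of exp(-c x) plus the
    classical one of exp(-c x) cos(b x); its bracket is bounded by [M], so it vanishes at
    infinity. *)
Lemma integral_expRcos (c b : R) : 0 < c ->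
  (\int[mu]_(x in `[0%R, +oo[) (expR (- (c * x)) * (1 + cos (b * x)))%:E
  = (c^-1 + c / (c ^+ 2 + b ^+ 2))%:E)%E.
Proof.
move=> c0.
have cb0 : c ^+ 2 + b ^+ 2 != 0 by rewrite gt_eqF// ltr_pwDl ?exprn_gt0 ?sqr_ge0.
have cn0 : c != 0 by rewrite gt_eqF.
pose F (x : R) := expR (- (c * x)) *
  (- c^-1 + (- c * cos (b * x) + b * sin (b * x)) / (c ^+ 2 + b ^+ 2)).
have dF (x : R) : is_derive x 1 F (expR (- (c * x)) * (1 + cos (b * x))).
  apply: is_derive_eq.
  by rewrite /GRing.scale/=; field; rewrite cb0 cn0.
pose M := c^-1 + (c + `|b|) / (c ^+ 2 + b ^+ 2).
have FM x : `|F x| <= expR (- (c * x)) * M.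
  rewrite normrM ger0_norm ?expR_ge0// ler_pM2l ?expR_gt0//.
  apply: (le_trans (ler_normD _ _)); rewrite normrN ger0_norm ?invr_ge0 ?(ltW c0)//.
  rewrite lerD2l normrM [X in _ * X]gtr0_norm ?invr_gt0 ?ltr_pwDl ?exprn_gt0 ?sqr_ge0//.
  rewrite ler_pM2r ?invr_gt0 ?ltr_pwDl ?exprn_gt0 ?sqr_ge0//.
  apply: (le_trans (ler_normD _ _)); rewrite !normrM normrN (gtr0_norm c0).
  apply: lerD; first by rewrite ler_piMr ?(ltW c0)// ler_norml cos_geN1 cos_le1.
  by rewrite ler_piMr// ler_norml sin_geN1 sin_le1.
have ecvg : expR (- (c * x)) @[x --> +oo%R] --> 0.
  have -> : (fun x => expR (- (c * x))) = (fun z => expR (- z)) \o (fun z => c * z) by [].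
  apply: (@cvg_comp _ _ _ _ _ _ (pinfty_nbhs R)); last exact: cvgr_expR.
  exact: gt0_cvgMry.
have Fcvg : F x @[x --> +oo%R] --> 0.
  apply/cvgr0Pnorm_le => e e0.
  have : expR (- (c * x)) * M @[x --> +oo%R] --> 0 * M by apply: cvgM => //; exact: cvg_cst.
  rewrite mul0r => /cvgr0Pnorm_le/(_ _ e0); apply: filterS => x h.
  by apply: (le_trans (FM x)); apply: (le_trans (ler_norm _)).
have cF : continuous F.
  move=> x; apply: differentiable_continuous; apply/derivable1_diffP.
  by have d := dF x; exact: ex_derive.
have cf : continuous (fun x : R => expR (- (c * x)) * (1 + cos (b * x))).
  move=> x; apply: differentiable_continuous; apply/derivable1_diffP.
  by apply: ex_derive.
rewrite (@ge0_continuous_FTC2y _ _ F _ 0)//.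
- rewrite /F !mulr0 oppr0 expR0 cos0 sin0 sub0e -EFinN; congr EFin.
  by field; rewrite cb0 cn0.
- exact: continuous_subspaceT.
- by apply: cvg_at_right_filter; exact: cF.
- by move=> x _; have d := dF x; rewrite derive1E derive_val.
Qed.

Definition abel (N x : R) : R := expR (- (2 * pi / N * `|x|)).

(** The Poisson kernel of the half-plane at height 1/N. The rate 2 pi / N in [abel] is the one whose
    transform is this kernel, the factor 2 pi coming from the normalization of [fourier]. *)
Definition poisson (N y : R) : R := N / (pi * (1 + (N * y) ^+ 2)).

Lemma abel_gt0 N x : 0 < abel N x.
Proof. exact: expR_gt0. Qed.

Lemma abel_le1 N x : 0 < N -> abel N x <= 1.
Proof.
move=> N0; rewrite expR_le1 oppr_le0 mulr_ge0// divr_ge0 ?(ltW N0)//.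
by rewrite mulr_ge0// pi_ge0.
Qed.

Lemma continuous_abel N : continuous (abel N).
Proof.
move=> x; apply: continuous_comp; last exact: continuous_expR.
apply: cvgN; apply: cvgM; first exact: cvg_cst.
exact: norm_continuous.
Qed.

Lemma measurable_abel N : measurable_fun setT (abel N).
Proof. by apply: continuous_measurable_fun; exact: continuous_abel. Qed.

Lemma integral_abel_cos (N b : R) : 0 < N ->
  (\int[mu]_x (abel N x * (1 + cos (b * x)))%:E
  = (2 * ((2 * pi / N)^-1 + (2 * pi / N) / ((2 * pi / N) ^+ 2 + b ^+ 2)))%:E)%E.
Proof.
move=> N0; have c0 : 0 < 2 * pi / N by rewrite divr_gt0// mulr_gt0// pi_gt0.
rewrite ge0_symfun_integralT.
- rewrite -set_itvcy EFinM -(integral_expRcos _ c0); congr (_ * _)%E.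
  by apply: eq_integral => x; rewrite inE/= in_itv/= andbT => x0; rewrite /abel ger0_norm.
- by move=> x; rewrite mulr_ge0 ?expR_ge0// -lerBlDl sub0r cos_geN1.
- move=> x; apply: cvgM; first exact: continuous_abel.
  apply: cvgD; first exact: cvg_cst.
  apply: continuous_comp; last exact: continuous_cos.
  by apply: cvgM; [exact: cvg_cst|exact: cvg_id].
- by move=> x /=; rewrite /abel normrN mulrN cosN.
Qed.

Lemma integral_abel (N : R) : 0 < N -> (\int[mu]_x (abel N x)%:E = (N / pi)%:E)%E.
Proof.
move=> N0; have pi0 : pi != 0 :> R by rewrite gt_eqF// pi_gt0.
have Nn0 : N != 0 by rewrite gt_eqF.
(* At frequency 0 the factor 1 + cos is the constant 2, so this value is twice the mass of
   [abel N]. *)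
have := integral_abel_cos 0 N0; under eq_integral do rewrite mul0r cos0 mulrC EFinM.
rewrite ge0_integralZl_EFin//; last 2 first.
- by move=> x _; rewrite lee_fin expR_ge0.
- by apply/measurable_EFinP; exact: measurable_abel.
move=> h; have {h} : ((1 + 1)^-1%:E * ((1 + 1)%:E * \int[mu]_x (abel N x)%:E) = (N / pi)%:E)%E.
  by rewrite h -EFinM; congr EFin; move: (pi) pi0 => p p0; field; rewrite Nn0 p0.
by rewrite muleA -EFinM mulVf// mul1e.
Qed.

Lemma cintegrable_abel (N : R) : 0 < N -> cintegrable (fun x => (abel N x)%:C%C).
Proof.
move=> N0; split.
  by apply: cmeasurableR; exact: measurable_abel.
under eq_integral do rewrite normcR gtr0_norm ?abel_gt0//.
by rewrite integral_abel// ltry.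
Qed.

(** The imaginary part vanishes because [abel N] is real and even, so its transform is its own
    conjugate. In the real part the cosine is written as (1 + cos) - 1, a difference of two
    nonnegative integrals already evaluated. *)
Lemma fourier_abel (N y : R) : 0 < N ->
  fourier (fun x => (abel N x)%:C%C) y = (poisson N y)%:C%C.
Proof.
move=> N0; have Wi := cintegrable_abel N0.
apply: eqc => /=; last first.
  have := fourier_flipJ y Wi.
  have -> : (fun t : R => ((abel N (- t))%:C%C)^* ) = (fun x => (abel N x)%:C%C).
    by apply/funext => t; apply: eqc; rewrite conjcE/= ?oppr0// /abel normrN.
  rewrite conjcE => /(congr1 (@complex.Im R))/= /eqP.
  by rewrite -subr_eq0 opprK -mulr2n mulrn_eq0/= => /eqP.
transitivity (\int[mu]_x (abel N x * (1 + cos (2 * pi * y * x)) - abel N x)).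
  congr Rintegral; apply/funext => x; rewrite /= mul0r subr0 cosN; ring.
have mabel : measurable_fun setT (EFin \o abel N).
  by apply/measurable_EFinP; exact: measurable_abel.
have pi0 : pi != 0 :> R by rewrite gt_eqF// pi_gt0.
have Nn0 : N != 0 by rewrite gt_eqF.
rewrite RintegralB//.
- rewrite /Rintegral integral_abel// integral_abel_cos//=.
  have Ny : 1 + (N * y) ^+ 2 != 0 by rewrite gt_eqF// ltr_pwDl ?sqr_ge0.
  rewrite /poisson; move: (pi) pi0 => p p0; field.
  rewrite Ny p0 Nn0 /= (_ : _ + _ = (2 * p) ^+ 2 * (1 + (N * y) ^+ 2)); last by ring.
  by rewrite mulf_neq0// expf_neq0// mulf_neq0.
- apply/integrableP; split.
    apply/measurable_EFinP; apply: measurable_funM; first exact: measurable_abel.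
    apply: measurable_funD => //; apply: measurableT_comp.
      by apply: continuous_measurable_fun; exact: continuous_cos.
    have := measurable_affine (2 * pi * y) 0.
    by under eq_fun do rewrite addr0.
  under eq_integral => x _.
    rewrite /= ger0_norm ?mulr_ge0 ?expR_ge0 -?lerBlDl ?sub0r ?cos_geN1//.
    over.
  by rewrite integral_abel_cos// ltry.
- exact: cintegrable_Re Wi.
Qed.

Lemma poisson_ge0 N y : 0 <= N -> 0 <= poisson N y.
Proof.
by move=> N0; rewrite divr_ge0// mulr_ge0 ?pi_ge0// addr_ge0 ?sqr_ge0.
Qed.

Lemma poissonN N y : poisson N (- y) = poisson N y.
Proof. by rewrite /poisson mulrN sqrrN. Qed.

Lemma poisson_scale N y : poisson N y = N * poisson 1 (N * y).
Proof. by rewrite /poisson !mul1r. Qed.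

Lemma continuous_poisson1 : continuous (poisson 1).
Proof.
have -> : poisson 1 = (fun y => pi^-1 * (oneDsqr y)^-1).
  by apply/funext => y; rewrite /poisson mul1r invfM mul1r.
by move=> x; apply: cvgM; [exact: cvg_cst|exact: continuous_oneDsqrV].
Qed.

Lemma measurable_poisson N : measurable_fun setT (poisson N).
Proof.
have -> : poisson N = (fun y => N * poisson 1 (N * y)).
  by apply/funext => y; exact: poisson_scale.
apply: measurable_funM => //; apply: (measurableT_comp (f := poisson 1)).
  by apply: continuous_measurable_fun; exact: continuous_poisson1.
have := measurable_affine N 0.
by under eq_fun do rewrite addr0.
Qed.

(** Rescaling reduces to N = 1, and evenness to the half-line, where the integral of 1 / (1 + y^2)
    is pi / 2. *)
Lemma integral_poisson N : 0 < N -> (\int[mu]_y (poisson N y)%:E = 1)%E.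
Proof.
move=> N0; have pi0 : pi != 0 :> R by rewrite gt_eqF// pi_gt0.
have m1 : measurable_fun setT (EFin \o poisson 1).
  by apply/measurable_EFinP; exact: measurable_poisson.
transitivity (\int[mu]_y (poisson 1 y)%:E)%E.
  rewrite -(ge0_integral_affine 0 (al := N) _ m1) ?gt_eqF//; last first.
    by move=> x; rewrite lee_fin poisson_ge0.
  rewrite -ge0_integralZl//=.
  - apply: eq_integral => y _; rewrite addr0 gtr0_norm// -EFinM.
    by rewrite poisson_scale.
  - apply: (measurableT_comp m1); exact: measurable_affine.
  - by move=> x _; rewrite lee_fin poisson_ge0.
have mq : measurable_fun setT (fun x : R => (oneDsqr x)^-1).
  by apply: continuous_measurable_fun; exact: continuous_oneDsqrV.
rewrite ge0_symfun_integralT.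
- rewrite -set_itvcy.
  under eq_integral do rewrite /poisson !mul1r invfM EFinM.
  rewrite ge0_integralZl_EFin ?invr_ge0 ?pi_ge0//.
  + rewrite integral0y_oneDsqr -!EFinM; congr EFin.
    by move: (pi) pi0 => p p0; field; rewrite p0.
  + by move=> x _; rewrite lee_fin invr_ge0 addr_ge0 ?sqr_ge0.
  + by apply/measurable_EFinP; apply: measurable_funTS; exact: mq.
- by move=> x; rewrite poisson_ge0.
- exact: continuous_poisson1.
- by move=> x /=; rewrite poissonN.
Qed.

Lemma cintegrable_poisson N : 0 < N -> cintegrable (fun y => (poisson N y)%:C%C).
Proof.
move=> N0; split; first by apply: cmeasurableR; exact: measurable_poisson.
under eq_integral do rewrite normcR ger0_norm ?(poisson_ge0 _ (ltW N0))//.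
by rewrite integral_poisson// ltry.
Qed.

End Poisson.

(** * The Plancherel inequalities and inversion *)

Section Bessel.
Variable R : realType.
Local Notation mu := (@lebesgue_measure R).
Implicit Types (f g : R -> R[i]).

Lemma fatou_le (u_ : nat -> R -> R) (u : R -> R) (M : \bar R) :
  (forall n, measurable_fun setT (u_ n)) -> (forall n x, 0 <= u_ n x) ->
  measurable_fun setT u -> (forall x, 0 <= u x) ->
  {ae mu, forall x, u_ n x @[n --> \oo] --> u x} ->
  (forall n, (\int[mu]_x (u_ n x)%:E <= M)%E) -> (\int[mu]_x (u x)%:E <= M)%E.
Proof.
move=> mu_ u0_ mu' u0 cu uM.
pose v n x := (u_ n x)%:E.
have mv n : measurable_fun setT (v n) by exact/measurable_EFinP.
have v0 n x : setT x -> (0 <= v n x)%E by rewrite lee_fin.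
have := fatou mu measurableT mv v0 => h.
apply: le_trans (le_trans _ h) _.
  apply: ae_ge0_le_integral => //.
  - by move=> x _; rewrite lee_fin.
  - exact/measurable_EFinP.
  - move=> x _; rewrite limn_einf_lim; apply: lime_ge.
      exact: is_cvg_einfs.
    by apply: nearW => n; apply: le_ereal_inf_tmp => _ [m /= _ <-]; exact: v0.
  - apply: (emeasurable_fun_cvg (fun n x => einfs (v^~ x) n)).
      by move=> n; exact: measurable_fun_einfs.
    by move=> x _; rewrite limn_einf_lim; exact: is_cvg_einfs.
  - apply: (ae_mono _ cu) => x cx _.
    have cv : v^~ x @ \oo --> (u x)%:E by apply/fine_cvgP; split => //; exact: nearW.
    by have [-> _] := cvg_limn_einf_sup cv.
rewrite limn_einf_lim; apply: lime_le; first exact: is_cvg_einfs.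
apply: nearW => n; apply: le_trans (uM n); apply: ereal_inf_lbound.
by exists n => //=.
Qed.

(** A Poisson mean is the inversion integral damped by [abel]: the multiplication formula transfers
    the transform to the modulated damping factor, where it becomes a Poisson kernel centered at
    [t], and evenness of the kernel adjusts the sign. *)
Lemma convolution_poisson g (N t : R) : 0 < N -> cintegrable g ->
  convolution g (fun y => (poisson N y)%:C%C) t =
  cintegral (fun x => fourier g x * modulation t (fun y => (abel N y)%:C%C) x).
Proof.
move=> N0 gi; rewrite fourier_swap//.
  apply: eq_cintegral => s; rewrite fourier_modulation fourier_abel//.
  by rewrite -[in RHS]poissonN opprB.
have := cintegrableMexpi (measurable_phase (- t)) (cintegrable_abel N0).
congr cintegrable; apply/funext => x; rewrite /modulation mulrC.
by congr (expi _ * _); ring.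
Qed.

(* Schur test: [2 a(s) a(t) <= a(s)^2 + a(t)^2] and the kernel has mass 1. *)
Lemma poisson_schur (a : R -> R) (N : R) : 0 < N -> measurable_fun setT a ->
  (forall x, 0 <= a x) ->
  (\int[mu]_s \int[mu]_t (a s * a t * poisson N (s - t))%:E <=
   \int[mu]_s (a s ^+ 2)%:E)%E.
Proof.
move=> N0 ma a0; have N0' := ltW N0.
have mP2 : measurable_fun setT (fun z : R * R => poisson N (z.1 - z.2)).
  apply: measurableT_comp; first exact: measurable_poisson.
  by apply: measurable_funB; [exact: measurable_fst|exact: measurable_snd].
have ma1 : measurable_fun setT (fun z : R * R => a z.1).
  exact: (measurableT_comp ma measurable_fst).
have ma2 : measurable_fun setT (fun z : R * R => a z.2).
  exact: (measurableT_comp ma measurable_snd).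
pose h1 (z : R * R) := 2^-1 * (a z.1 ^+ 2 * poisson N (z.1 - z.2)).
pose h2 (z : R * R) := 2^-1 * (a z.2 ^+ 2 * poisson N (z.1 - z.2)).
have mh1 : measurable_fun setT h1.
  by apply: measurable_funM => //; apply: measurable_funM => //; exact: measurable_funX.
have mh2 : measurable_fun setT h2.
  by apply: measurable_funM => //; apply: measurable_funM => //; exact: measurable_funX.
have h10 z : 0 <= h1 z by rewrite mulr_ge0// mulr_ge0 ?sqr_ge0 ?poisson_ge0.
have h20 z : 0 <= h2 z by rewrite mulr_ge0// mulr_ge0 ?sqr_ge0 ?poisson_ge0.
have mE1 : measurable_fun setT (EFin \o h1) by exact/measurable_EFinP.
have mE2 : measurable_fun setT (EFin \o h2) by exact/measurable_EFinP.
have ma2E : measurable_fun setT (fun t => (a t ^+ 2)%:E).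
  by apply/measurable_EFinP; exact: measurable_funX.
have a2E0 t : (0 <= (a t ^+ 2)%:E)%E by rewrite lee_fin sqr_ge0.
have mPs (s : R) : measurable_fun setT (fun t : R => poisson N (s - t)).
  exact: (measurableT_comp mP2 (pair1_measurable s)).
have mPt (t : R) : measurable_fun setT (fun s : R => poisson N (s - t)).
  exact: (measurableT_comp mP2 (pair2_measurable t)).
have mPE : measurable_fun setT (EFin \o poisson N).
  by apply/measurable_EFinP; exact: measurable_poisson.
have PE0 x : (0 <= (EFin \o poisson N) x)%E by rewrite lee_fin poisson_ge0.
have e1 s : (\int[mu]_t (h1 (s, t))%:E = (2^-1 * a s ^+ 2)%:E)%E.
  under eq_integral do rewrite /h1 /= mulrA EFinM.
  rewrite ge0_integralZl_EFin//.
  - rewrite (ge0_integral_flip s mPE PE0) integral_poisson// mule1//.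
  - by move=> t _; rewrite lee_fin poisson_ge0.
  - by apply/measurable_EFinP; exact: mPs.
  - by rewrite mulr_ge0// sqr_ge0.
have e2 t : (\int[mu]_s (h2 (s, t))%:E = (2^-1 * a t ^+ 2)%:E)%E.
  under eq_integral do rewrite /h2 /= mulrA EFinM.
  rewrite ge0_integralZl_EFin//.
  - rewrite (ge0_integral_shift t mPE PE0) integral_poisson// mule1//.
  - by move=> s _; rewrite lee_fin poisson_ge0.
  - by apply/measurable_EFinP; exact: mPt.
  - by rewrite mulr_ge0// sqr_ge0.
have half : (\int[mu]_s (2^-1 * a s ^+ 2)%:E = 2^-1%:E * \int[mu]_s (a s ^+ 2)%:E)%E.
  by under eq_integral do rewrite EFinM; rewrite ge0_integralZl_EFin.
apply: (@le_trans _ _ (\int[mu]_s \int[mu]_t ((h1 (s, t))%:E + (h2 (s, t))%:E))%E).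
  apply: ge0_le_integral => //=.
  - move=> s _; apply: integral_ge0 => t _.
    by rewrite lee_fin mulr_ge0 ?poisson_ge0// mulr_ge0.
  - apply: (measurable_fun_fubini_tonelli_F (m2 := mu)
      (fun z => (a z.1 * a z.2 * poisson N (z.1 - z.2))%:E)).
      by apply/measurable_EFinP; apply: measurable_funM => //; exact: measurable_funM.
    by move=> z; rewrite lee_fin mulr_ge0 ?poisson_ge0// mulr_ge0.
  - apply: (measurable_fun_fubini_tonelli_F (m2 := mu)
      (fun z => ((EFin \o h1) z + (EFin \o h2) z)%E)).
      exact: emeasurable_funD.
    by move=> z; rewrite adde_ge0// lee_fin.
  move=> s _; apply: ge0_le_integral => //=.
  - by move=> t _; rewrite lee_fin mulr_ge0 ?poisson_ge0// mulr_ge0.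
  - apply/measurable_EFinP; apply: measurable_funM; last exact: mPs.
    by apply: measurable_funM.
  - apply: emeasurable_funD.
      exact: (measurableT_comp mE1 (pair1_measurable s)).
    exact: (measurableT_comp mE2 (pair1_measurable s)).
  - move=> t _; rewrite -EFinD lee_fin /h1 /h2/= -!mulrDr -mulrDl mulrA.
    rewrite ler_wpM2r ?poisson_ge0//.
    have := sqr_ge0 (a s - a t); lra.
under eq_integral => s _.
  rewrite ge0_integralD//; last 4 first.
  - by move=> t _; rewrite lee_fin.
  - exact: (measurableT_comp mE1 (pair1_measurable s)).
  - by move=> t _; rewrite lee_fin.
  - exact: (measurableT_comp mE2 (pair1_measurable s)).
  rewrite e1.
  over.
rewrite ge0_integralD//; last 4 first.
- by move=> s _; rewrite lee_fin mulr_ge0// sqr_ge0.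
- by apply/measurable_EFinP; apply: measurable_funM => //; exact: measurable_funX.
- by move=> s _; apply: integral_ge0 => t _; rewrite lee_fin.
- exact: (measurable_fun_fubini_tonelli_F (m2 := mu) (EFin \o h2)).
have -> : (\int[mu]_s \int[mu]_t (h2 (s, t))%:E = \int[mu]_t \int[mu]_s (h2 (s, t))%:E)%E.
  exact: (fubini_tonelli (m1 := mu) (m2 := mu) (EFin \o h2)).
under [X in (_ + X)%E]eq_integral do rewrite e2.
rewrite half -ge0_muleDl ?lee_fin// -EFinD.
by rewrite (_ : 2^-1 + 2^-1 = 1 :> R) ?mul1e//; field.
Qed.

Lemma cvg_abel1 (x : R) : abel n.+1%:R x @[n --> \oo] --> (1 : R).
Proof.
rewrite /abel -[X in _ --> X]expR0.
apply: continuous_cvg; first exact: continuous_expR.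
rewrite -oppr0; apply: cvgN; rewrite -(mul0r `|x|); apply: cvgM; last exact: cvg_cst.
rewrite -(mulr0 (2 * pi)); apply: cvgM; first exact: cvg_cst.
exact: (@cvg_harmonic R).
Qed.

(** The integral of |g^|^2 damped by [abel] is a pairing of [g^] with [q], the damped conjugate of
    [g^]. The multiplication formula turns it into the pairing of [g] with the conjugate of its
    Poisson mean, which the Schur test for |g| bounds uniformly in [N]; Fatou then removes the
    damping. Boundedness of [g^] by the L1 norm of [g] makes [q] integrable. *)
Lemma fourier_L2_le g : cintegrable g ->
  (\int[mu]_x ((normc (fourier g x)) ^+ 2)%:E <= \int[mu]_t ((normc (g t)) ^+ 2)%:E)%E.
Proof.
move=> gi; have mg := gi.1.
have mfg := cmeasurable_fourier mg.
apply: (@fatou_le (fun n x => normc (fourier g x) ^+ 2 * abel n.+1%:R x)).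
- move=> n; apply: measurable_funM; last exact: measurable_abel.
  by apply: measurable_funX; exact: measurable_normc.
- by move=> n x; rewrite mulr_ge0 ?sqr_ge0 ?expR_ge0.
- by apply: measurable_funX; exact: measurable_normc.
- by move=> x; rewrite sqr_ge0.
- apply: aeW => x; rewrite -[X in _ --> X]mulr1; apply: cvgM; first exact: cvg_cst.
  exact: cvg_abel1.
move=> n; set N := n.+1%:R; have N0 : 0 < N by rewrite ltr0n.
pose W y := (abel N y)%:C%C.
have Wi : cintegrable W := cintegrable_abel N0.
pose q x := (fourier g x)^* * W x.
pose M := fine (\int[mu]_t (normc (g t))%:E)%E.
have qi : cintegrable q.
  apply: (cintegrable_dom _ (cintegrableZ M%:C%C Wi)).
    by apply: cmeasurableM; [exact: cmeasurableJ|exact: Wi.1].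
  move=> x; rewrite !normcM normc_conj ler_wpM2r ?normc_ge0//.
  by rewrite normcR (le_trans (normc_fourier x gi))// ler_norm.
have Fq s : fourier q s = (convolution g (fun y => (poisson N y)%:C%C) s)^*.
  have Mi : cintegrable (fun x => fourier g x * modulation s W x).
    apply: (cintegrable_dom _ (cintegrableZ M%:C%C Wi)).
      apply: cmeasurableM => //; apply: cmeasurableM; last exact: Wi.1.
      apply: cmeasurable_expi; have := measurable_affine (2 * pi * s) 0.
      by under eq_fun do rewrite addr0.
    move=> x; rewrite !normcM normc_expi mul1r ler_wpM2r ?normc_ge0//.
    by rewrite normcR (le_trans (normc_fourier x gi))// ler_norm.
  rewrite convolution_poisson// -cintegralJ//; apply: eq_cintegral => x.
  rewrite /q rmorphM rmorphM -[LHS]mulrA; congr (_ * _).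
  rewrite mulrC; congr (_ * _); first exact: expiN.
  exact/esym/conjcR.
have key : cintegral (fun x => fourier g x * q x) =
    cintegral (fun s => g s * (convolution g (fun y => (poisson N y)%:C%C) s)^*).
  rewrite (fourier_swap gi qi); congr cintegral; apply/funext => s; congr (_ * _).
  exact: Fq.
have gqE x : fourier g x * q x = (normc (fourier g x) ^+ 2 * abel N x)%:C%C.
  by rewrite /q mulrA mulcJ -rmorphM.
(* The integrand is real and nonnegative, so its integral is the modulus of its complex integral, to
   which [key] applies. *)
have -> : (\int[mu]_x (normc (fourier g x) ^+ 2 * abel N x)%:E =
    (normc (cintegral (fun x => fourier g x * q x)))%:E)%E.
  have mI : cintegrable (fun x => fourier g x * q x).
    apply: (cintegrable_dom _ (cintegrableZ M%:C%C qi)).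
      by apply: cmeasurableM => //; exact: qi.1.
    move=> x; rewrite normcM [X in _ <= X]normcM ler_wpM2r ?normc_ge0//.
    by rewrite normcR (le_trans (normc_fourier x gi))// ler_norm.
  have gqF : (fun x => fourier g x * q x) =
      (fun x => (normc (fourier g x) ^+ 2 * abel N x)%:C%C) by apply/funext.
  rewrite gqF; rewrite gqF in mI.
  have -> : cintegral (fun x => (normc (fourier g x) ^+ 2 * abel N x)%:C%C) =
      (\int[mu]_x (normc (fourier g x) ^+ 2 * abel N x))%:C%C.
    by apply: eqc => //=; rewrite Rintegral_cst// mul0r.
  rewrite normcR ger0_norm; last first.
    by apply: Rintegral_ge0 => x _; rewrite mulr_ge0 ?sqr_ge0 ?expR_ge0.
  by rewrite /Rintegral fineK//; exact: (integrable_fin_num measurableT (cintegrable_Re mI)).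
rewrite key; apply: (le_trans (le_normc_cintegral _)).
  apply: cmeasurableM => //; apply: cmeasurableJ.
  by have [] := cintegrable_convolution gi (cintegrable_poisson N0).
apply: le_trans _ (poisson_schur N0 (measurable_normc mg) (fun x => normc_ge0 (g x))).
have mG : cmeasurable (fun z : R * R => g z.1 * (g z.2 * (poisson N (z.1 - z.2))%:C%C)).
  apply: cmeasurableM; first exact: (cmeasurable_comp mg measurable_fst).
  apply: cmeasurableM; first exact: (cmeasurable_comp mg measurable_snd).
  apply: cmeasurableR; apply: measurableT_comp; first exact: measurable_poisson.
  by apply: measurable_funB; [exact: measurable_fst|exact: measurable_snd].
have nG z : normc (g z.1 * (g z.2 * (poisson N (z.1 - z.2))%:C%C)) =
    normc (g z.1) * normc (g z.2) * poisson N (z.1 - z.2).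
  by rewrite !normcM normcR ger0_norm ?poisson_ge0 ?(ltW N0)// mulrA.
apply: ge0_le_integral => //=.
- by move=> s _; rewrite lee_fin normc_ge0.
- apply: measurable_normcE; apply: cmeasurableM => //; apply: cmeasurableJ.
  by have [] := cintegrable_convolution gi (cintegrable_poisson N0).
- apply: (measurable_fun_fubini_tonelli_F (m2 := mu)
    (fun z => (normc (g z.1) * normc (g z.2) * poisson N (z.1 - z.2))%:E)).
    by apply/measurable_EFinP; have := measurable_normc mG; under eq_fun do rewrite nG.
  by move=> z; rewrite lee_fin -nG normc_ge0.
move=> s _; rewrite normcM normc_conj EFinM.
have mGs := cmeasurable_comp mG (pair1_measurable s).
have mc : cmeasurable (fun t => g t * (poisson N (s - t))%:C%C).
  apply: cmeasurableM => //; apply: cmeasurableR.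
  apply: measurableT_comp; first exact: measurable_poisson.
  have := measurable_affine (- 1) s.
  by under eq_fun do rewrite mulN1r addrC.
under [X in (_ <= X)%E]eq_integral do rewrite -mulrA EFinM.
rewrite ge0_integralZl_EFin ?normc_ge0//; last 2 first.
- by move=> t _; rewrite lee_fin mulr_ge0 ?normc_ge0 ?poisson_ge0 ?(ltW N0).
- apply/measurable_EFinP; have := measurable_normc mc.
  by under eq_fun do rewrite normcM normcR ger0_norm ?poisson_ge0 ?(ltW N0)//.
apply: lee_wpmul2l; first by rewrite lee_fin normc_ge0.
apply: (le_trans (le_normc_cintegral mc)).
rewrite le_eqVlt; apply/orP; left; apply/eqP; apply: eq_integral => t _.
by rewrite normcM normcR ger0_norm ?poisson_ge0 ?(ltW N0).
Qed.
End Bessel.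

(** * Convergence of Poisson means *)

Section Approximation.
Variable R : realType.
Local Notation mu := (@lebesgue_measure R).
Implicit Types (f g h k : R -> R[i]).

Lemma cintegralB f g : cintegrable f -> cintegrable g ->
  cintegral (fun t => f t - g t) = cintegral f - cintegral g.
Proof.
move=> fi gi; have gN := cintegrableZ (- 1) gi.
rewrite -mulN1r -cintegralZ// -cintegralD//.
by apply: eq_cintegral => t; rewrite mulN1r.
Qed.

Lemma cintegralC (u : R -> R) : mu.-integrable setT (EFin \o u) ->
  cintegral (fun t => (u t)%:C%C) = (\int[mu]_t u t)%:C%C.
Proof. by move=> iu; apply: eqc => //=; rewrite Rintegral_cst// mul0r. Qed.

Lemma ler_dist_normc (z w : R[i]) : `|normc z - normc w| <= normc (z - w).
Proof.
have h (x y : R[i]) : normc x - normc y <= normc (x - y).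
  by rewrite lerBlDr -{1}(subrK y x) le_normcD.
rewrite ler_norml h andbT lerNl opprB (le_trans (h _ _))//.
by rewrite -normcN opprB.
Qed.

Lemma cvg_normc (z_ : nat -> R[i]) (z : R[i]) :
  normc (z_ n - z) @[n --> \oo] --> (0 : R) -> normc (z_ n) @[n --> \oo] --> normc z.
Proof.
move=> h; apply/cvgrPdist_le => e e0.
move/cvgr0Pnorm_le : h => /(_ _ e0); apply: filterS => n; rewrite ger0_norm ?normc_ge0//.
by apply: le_trans; rewrite distrC ler_dist_normc.
Qed.

Lemma cvg_le_ereal (u : nat -> R) (l : R) (M : \bar R) :
  u n @[n --> \oo] --> l -> (forall n, (u n)%:E <= M)%E -> (l%:E <= M)%E.
Proof.
move=> ul uM.
have ul' : (u n)%:E @[n --> \oo] --> l%:E by apply/fine_cvgP; split => //; exact: nearW.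
rewrite -(cvg_lim _ ul')//; apply: lime_le; first by apply/cvg_ex; exists l%:E.
exact: nearW.
Qed.

Lemma le_cvg0_ereal (u : nat -> R) (v : nat -> \bar R) : (forall n, 0 <= u n) ->
  (forall n, (u n)%:E <= v n)%E -> v n @[n --> \oo] --> 0%E ->
  u n @[n --> \oo] --> (0 : R).
Proof.
move=> u0 uv v0.
have : (u n)%:E @[n --> \oo] --> 0%E.
  apply: (@squeeze_cvge _ _ _ _ (fun=> 0%E) _ v) => //; last exact: cvg_cst.
  by apply: nearW => n; rewrite lee_fin u0 uv.
by move/fine_cvgP => [].
Qed.

Lemma cintegral_poisson (N : R) : 0 < N ->
  cintegral (fun y => (poisson N y)%:C%C) = 1.
Proof.
move=> N0; rewrite cintegralC; last exact: cintegrable_Re (cintegrable_poisson N0).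
by rewrite /Rintegral integral_poisson.
Qed.

Lemma cintegrable_bounded_mul k g (B : R) : cmeasurable k -> cintegrable g ->
  (forall s, normc (k s) <= B) -> cintegrable (fun s => k s * g s).
Proof.
move=> mk gi kB; apply: (cintegrable_dom _ (cintegrableZ B%:C%C gi)).
  by apply: cmeasurableM => //; exact: gi.1.
move=> s; rewrite normcM [X in _ <= X]normcM ler_wpM2r ?normc_ge0//.
by rewrite normcR (le_trans (kB s))// ler_norm.
Qed.

(** Since the kernel has mass 1, the difference is a mean of [k (t - s) - k t]. Substituting s = u /
    N freezes the kernel at [poisson 1] and moves the dependence on N into the argument of [k], so
    dominated convergence applies with majorant [2 * B * poisson 1 u]. Continuity at [t] is used
    only along the sequences t - u / N. *)
Lemma cvg_convolution_poisson k (t B : R) : cmeasurable k ->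
  (forall s, normc (k s) <= B) ->
  (forall u, normc (k (t - u / n.+1%:R) - k t) @[n --> \oo] --> (0 : R)) ->
  normc (convolution k (fun y => (poisson n.+1%:R y)%:C%C) t - k t)
    @[n --> \oo] --> (0 : R).
Proof.
move=> mk kB kt.
have mka (al b : R) : cmeasurable (fun s : R => k (al * s + b)).
  exact: (cmeasurable_comp mk (measurable_affine al b)).
have md (al b : R) : measurable_fun setT (fun s : R => normc (k (al * s + b) - k t)).
  by apply: measurable_normc; apply: cmeasurableD => //; exact: cmeasurable_cst.
pose J n := (\int[mu]_u (normc (k (t - u / n.+1%:R) - k t) * poisson 1 u)%:E)%E.
have mJ n : measurable_fun setT
    (fun u : R => normc (k (t - u / n.+1%:R) - k t) * poisson 1 u).
  apply: measurable_funM; last exact: measurable_poisson.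
  suff -> : (fun u : R => normc (k (t - u / n.+1%:R) - k t)) =
    (fun s => normc (k (- n.+1%:R^-1 * s + t) - k t)) by exact: md.
  apply/funext => u.
  by congr (normc (k _ - _)); rewrite mulNr [RHS]addrC [_^-1 * u]mulrC.
apply: (@le_cvg0_ereal _ J) => [n|n|]; first exact: normc_ge0.
  set N := n.+1%:R; have N0 : 0 < N by rewrite ltr0n.
  have Nn0 : N != 0 by rewrite gt_eqF.
  have Pi := cintegrable_poisson N0.
  pose F s := k (t - s) * (poisson N s)%:C%C.
  have mkt : cmeasurable (fun s : R => k (t - s)).
    by have := mka (- 1) t; under eq_fun do rewrite mulN1r addrC.
  have Fi : cintegrable F by apply: (@cintegrable_bounded_mul _ _ B).
  have -> : convolution k (fun y => (poisson N y)%:C%C) t - k t =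
      cintegral (fun s => (k (t - s) - k t) * (poisson N s)%:C%C).
    transitivity (cintegral F - cintegral (fun s => k t * (poisson N s)%:C%C)).
      rewrite cintegralZ// cintegral_poisson// mulr1; congr (_ - _).
      rewrite -(cintegral_flip t)//; apply: eq_cintegral => s.
      by rewrite /F (_ : t - (t - s) = s)//; ring.
    rewrite -cintegralB//; last exact: cintegrableZ.
    by apply: eq_cintegral => s; rewrite mulrBl.
  apply: (le_trans (le_normc_cintegral _)).
    apply: cmeasurableM; last exact: Pi.1.
    by apply: cmeasurableD => //; exact: cmeasurable_cst.
  rewrite le_eqVlt; apply/orP; left; apply/eqP.
  rewrite /J -[RHS](ge0_integral_affine 0 Nn0) ?gtr0_norm//; last 2 first.
  - by apply/measurable_EFinP; exact: mJ.
  - by move=> u; rewrite lee_fin mulr_ge0 ?normc_ge0 ?poisson_ge0.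
  rewrite -[RHS]ge0_integralZl_EFin ?(ltW N0)//; last 2 first.
  - by move=> u _; rewrite lee_fin mulr_ge0 ?normc_ge0 ?poisson_ge0.
  - have mE : measurable_fun setT (fun u : R =>
        (normc (k (t - u / n.+1%:R) - k t) * poisson 1 u)%:E).
      by apply/measurable_EFinP; exact: mJ.
    exact: (measurableT_comp mE (measurable_affine N 0)).
  apply: eq_integral => s _; rewrite -EFinM addr0; congr EFin.
  rewrite normcM normcR ger0_norm ?poisson_ge0 ?(ltW N0)// poisson_scale mulrCA.
  by rewrite -/N [N * s]mulrC mulfK.
pose G (u : R) := (2 * B * poisson 1 u)%:E.
have B0 : 0 <= B by apply: le_trans (kB 0); exact: normc_ge0.
have iG : mu.-integrable setT G.
  have := integrableZl measurableT (2 * B) (cintegrable_Re (cintegrable_poisson (ltr01 : 0 < 1 :> R))).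
  exact: eq_integrable.
have := @dominated_convergence _ _ _ mu setT measurableT
  (fun n u => (normc (k (t - u / n.+1%:R) - k t) * poisson 1 u)%:E) (fun=> 0%E) G.
case.
- by move=> n; apply/measurable_EFinP; exact: mJ.
- exact: measurable_cst.
- apply: aeW => u _; apply/fine_cvgP; split; first exact: nearW.
  have : normc (k (t - u / n.+1%:R) - k t) * poisson 1 u @[n --> \oo] --> 0 * poisson 1 u.
    by apply: cvgM; [exact: kt|exact: cvg_cst].
  by rewrite mul0r.
- exact: iG.
- apply: aeW => u n _; rewrite gee0_abs; last first.
    by rewrite lee_fin; apply: mulr_ge0; [exact: normc_ge0|exact: poisson_ge0].
  rewrite lee_fin; apply: ler_wpM2r; first exact: poisson_ge0.
  apply: (le_trans (le_normcD _ _)).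
  by rewrite normcN mulr_natl mulr2n lerD.
by move=> _ _; rewrite integral0.
Qed.

End Approximation.

(** * Averages over small intervals *)

Section Averages.
Variable R : realType.
Local Notation mu := (@lebesgue_measure R).
Implicit Types (f g h k : R -> R[i]).

(** Convolution with it is the mean over the ball of radius [r]; writing the mean as a convolution
    gives access to its Fourier transform. *)
Definition box (r x : R) : R := (2 * r)^-1 * \1_(ball (0 : R) r) x.

Lemma boxE (r x : R) : box r x = if `|x| < r then (2 * r)^-1 else 0.
Proof.
rewrite /box indicE; case: ifPn => xr.
  by rewrite mem_set ?mulr1//= /ball/= sub0r normrN.
by rewrite memNset ?mulr0//= /ball/= sub0r normrN; exact/negP.
Qed.

Lemma box_ge0 (r x : R) : 0 < r -> 0 <= box r x.
Proof. by move=> r0; rewrite boxE; case: ifPn => // _; rewrite invr_ge0 mulr_ge0// ltW. Qed.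

Lemma box_le (r x : R) : 0 < r -> box r x <= (2 * r)^-1.
Proof.
by move=> r0; rewrite boxE; case: ifPn => // _; rewrite invr_ge0 mulr_ge0// ltW.
Qed.

Lemma measurable_box (r : R) : measurable_fun setT (box r).
Proof.
by apply: measurable_funM => //; apply: measurable_indic; exact: measurable_ball.
Qed.

Lemma integral_box (r : R) : 0 < r -> (\int[mu]_x (box r x)%:E = 1)%E.
Proof.
move=> r0; under eq_integral do rewrite /box EFinM.
have mb : measurable (ball (0 : R) r) := measurable_ball _ _.
rewrite ge0_integralZl_EFin ?invr_ge0 ?mulr_ge0 ?(ltW r0)//.
  rewrite integral_indic//= setIT [X in (_ * X)%E](lebesgue_measure_ball _ (ltW r0)).
  by rewrite -EFinM; congr EFin; field; rewrite gt_eqF.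
by apply/measurable_EFinP; exact: measurable_indic.
Qed.

Lemma cintegrable_box (r : R) : 0 < r -> cintegrable (fun x => (box r x)%:C%C).
Proof.
move=> r0; split; first by apply: cmeasurableR; exact: measurable_box.
under eq_integral do rewrite normcR ger0_norm ?box_ge0//.
by rewrite integral_box// ltry.
Qed.

Lemma cvg_box (r x : R) (x_ : nat -> R) : `|x| != r -> x_ n @[n --> \oo] --> x ->
  box r (x_ n) @[n --> \oo] --> box r x.
Proof.
move=> xr cx; have cn : `|x_ n| @[n --> \oo] --> `|x| by exact: cvg_norm.
apply/cvgrPdist_lt => e e0.
suff : \forall n \near \oo, box r (x_ n) = box r x.
  by apply: filterS => n ->; rewrite subrr normr0.
have [xr'|xr'] := ltP `|x| r.
  have : \forall n \near \oo, `|x_ n| < r by exact: (cvgr_lt `|x| cn).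
  by apply: filterS => n h; rewrite !boxE h xr'.
have {}xr' : r < `|x| by rewrite lt_neqAle eq_sym xr.
have : \forall n \near \oo, r < `|x_ n| by exact: (cvgr_gt `|x| cn).
by apply: filterS => n h; rewrite !boxE !ltNge !ltW.
Qed.

Lemma normc_convolution_box h (r t : R) : 0 < r -> cintegrable h ->
  normc (convolution h (fun x => (box r x)%:C%C) t) <=
  (2 * r)^-1 * fine (\int[mu]_s (normc (h s))%:E)%E.
Proof.
move=> r0 hi; have r1 : 0 <= (2 * r)^-1 by rewrite invr_ge0 mulr_ge0// ltW.
have hfin : (\int[mu]_s (normc (h s))%:E)%E \is a fin_num.
  by rewrite ge0_fin_numE ?integral_normc_ge0//; exact: hi.2.
have mb : measurable_fun setT (fun s : R => box r (t - s)).
  apply: measurableT_comp; first exact: measurable_box.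
  by have := measurable_affine (- 1) t; under eq_fun do rewrite mulN1r addrC.
rewrite -lee_fin EFinM fineK//; apply: (le_trans (le_normc_cintegral _)).
  by apply: cmeasurableM; [exact: hi.1|exact: cmeasurableR].
rewrite -ge0_integralZl_EFin//; last 2 first.
- by move=> s _; rewrite lee_fin normc_ge0.
- by apply: measurable_normcE; exact: hi.1.
apply: ge0_le_integral => //.
- by move=> s _; rewrite lee_fin normc_ge0.
- apply: measurable_normcE; apply: cmeasurableM; first exact: hi.1.
  exact: cmeasurableR.
- by apply: emeasurable_funM => //; apply: measurable_normcE; exact: hi.1.
- move=> s _; rewrite -EFinM lee_fin normcM normcR ger0_norm ?box_ge0// mulrC.
  by rewrite ler_wpM2r ?normc_ge0// box_le.
Qed.

(** As [h] is merely integrable, continuity has to come from the box: the shift acts on [box], which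
    is locally constant off its two endpoints. Hence the integrand tends to 0 for every [s] other
    than [t - r] and [t + r]. *)
Lemma cvg_convolution_box h (r t : R) (d : nat -> R) : 0 < r -> cintegrable h ->
  d n @[n --> \oo] --> (0 : R) ->
  normc (convolution h (fun x => (box r x)%:C%C) (t - d n) -
         convolution h (fun x => (box r x)%:C%C) t) @[n --> \oo] --> (0 : R).
Proof.
move=> r0 hi d0; have mh := hi.1.
have r1 : 0 <= (2 * r)^-1 by rewrite invr_ge0 mulr_ge0// ltW.
have mb (x : R) : measurable_fun setT (fun s : R => box r (x - s)).
  apply: measurableT_comp; first exact: measurable_box.
  by have := measurable_affine (- 1) x; under eq_fun do rewrite mulN1r addrC.
have mbd n : measurable_fun setT (fun s : R => `|box r (t - d n - s) - box r (t - s)|).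
  by apply: measurableT_comp => //; exact: measurable_funB.
pose J n := (\int[mu]_s (normc (h s) * `|box r (t - d n - s) - box r (t - s)|)%:E)%E.
have mJ n : measurable_fun setT
    (fun s : R => normc (h s) * `|box r (t - d n - s) - box r (t - s)|).
  by apply: measurable_funM => //; exact: measurable_normc.
have bi x : cintegrable (fun s => h s * (box r (x - s))%:C%C).
  have -> : (fun s => h s * (box r (x - s))%:C%C) = (fun s => (box r (x - s))%:C%C * h s).
    by apply/funext => s; rewrite mulrC.
  apply: (@cintegrable_bounded_mul _ _ _ (2 * r)^-1) => //; first exact: cmeasurableR.
  by move=> s; rewrite normcR ger0_norm ?box_le ?box_ge0.
apply: (@le_cvg0_ereal _ _ J) => [n|n|]; first exact: normc_ge0.
  rewrite -cintegralB//.
  apply: (le_trans (le_normc_cintegral _)).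
    have := cintegrableD (bi (t - d n)) (cintegrableZ (- 1) (bi t)).
    by move=> [+ _]; under eq_fun do rewrite mulN1r.
  rewrite le_eqVlt; apply/orP; left; apply/eqP; apply: eq_integral => s _.
  by rewrite -mulrBr normcM -rmorphB normcR.
(* Both values of the box lie between 0 and [(2 * r)^-1], hence so does the modulus of their
   difference. *)
pose G (s : R) := ((2 * r)^-1 * normc (h s))%:E.
have iG : mu.-integrable setT G.
  apply/integrableP; split.
    by apply/measurable_EFinP; apply: measurable_funM => //; exact: measurable_normc.
  have [_ foo] := cintegrableZ ((2 * r)^-1)%:C%C hi.
  apply: le_lt_trans foo; rewrite le_eqVlt; apply/orP; left; apply/eqP.
  apply: eq_integral => s _; rewrite gee0_abs ?lee_fin ?mulr_ge0 ?normc_ge0//.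
  by rewrite normcM normcR ger0_norm.
have := @dominated_convergence _ _ _ mu setT measurableT
  (fun n s => (normc (h s) * `|box r (t - d n - s) - box r (t - s)|)%:E) (fun=> 0%E) G.
case.
- by move=> n; apply/measurable_EFinP; exact: mJ.
- exact: measurable_cst.
- have ne (c : R) : {ae mu, forall s, s <> c}.
    exists [set c]; split; [exact: measurable_set1|exact: lebesgue_measure_set1|].
    by move=> s /= /contrapT.
  apply: (ae_mono _ (ae_and (ne (t - r)) (ne (t + r)))) => s [s1 s2] _.
  apply/fine_cvgP; split; first exact: nearW.
  have bc : box r (t - d n - s) @[n --> \oo] --> box r (t - s).
    apply: cvg_box.
      apply/eqP => e; have : t - s = r \/ t - s = - r.
        have [|] := lerP 0 (t - s) => ?; move: e.
          by rewrite ger0_norm//; lra.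
        by rewrite ltr0_norm//; lra.
      by case=> ?; [apply: s1|apply: s2]; lra.
    have : t - d n - s @[n --> \oo] --> t - 0 - s.
      by apply: cvgB; [apply: cvgB => //|]; exact: cvg_cst.
    by rewrite subr0.
  have : normc (h s) * `|box r (t - d n - s) - box r (t - s)| @[n --> \oo] -->
      normc (h s) * `|box r (t - s) - box r (t - s)|.
    apply: cvgM; first exact: cvg_cst.
    by apply: cvg_norm; apply: cvgB => //; exact: cvg_cst.
  by rewrite subrr normr0 mulr0.
- exact: iG.
- apply: aeW => s n _; rewrite gee0_abs ?lee_fin ?mulr_ge0 ?normc_ge0//.
  rewrite mulrC ler_wpM2r ?normc_ge0// ler_norml.
  have := box_le (t - d n - s) r0; have := box_le (t - s) r0.
  have := box_ge0 (t - d n - s) r0; have := box_ge0 (t - s) r0.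
  by move=> ? ? ? ?; apply/andP; split; lra.
by move=> _ _; rewrite integral0.
Qed.

(** At a common Lebesgue point of the real and imaginary parts, the error is at most the mean of
    |h(s) - h(t)| over the ball, which is bounded by the sum of the mean oscillations [davg] of the
    two parts. *)
Lemma ae_cvg_convolution_box h : cintegrable h ->
  {ae mu, forall t, normc (convolution h (fun x => (box n.+1%:R^-1 x)%:C%C) t - h t)
    @[n --> \oo] --> (0 : R)}.
Proof.
move=> hi; have mh := hi.1.
have lR := lebesgue_differentiation (open_integrable_locally openT (cintegrable_Re hi)).
have lI := lebesgue_differentiation (open_integrable_locally openT (cintegrable_Im hi)).
apply: (ae_mono _ (ae_and lR lI)) => t [pR pI].
set hR := (fun s => complex.Re (h s)) in pR; set hI := (fun s => complex.Im (h s)) in pI.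
(* The differentiation theorem is a limit over positive radii, so the radii must converge to 0 from
   the right. *)
have cr : (n.+1%:R^-1 : R) @[n --> \oo] --> (0 : R)^'+.
  move=> A hA.
  have H : \forall n \near \oo, 0 < (n.+1%:R^-1 : R) -> A n.+1%:R^-1.
    exact: (@cvg_harmonic R [set x | 0 < x -> A x] hA).
  suff : \forall n \near \oo, A n.+1%:R^-1 by [].
  by move: H; apply: filterS => n; apply; rewrite invr_gt0 ltr0n.
have cR : davg hR t n.+1%:R^-1 @[n --> \oo] --> 0%E by apply: cvg_comp cr pR.
have cI : davg hI t n.+1%:R^-1 @[n --> \oo] --> 0%E by apply: cvg_comp cr pI.
have cRI : (davg hR t n.+1%:R^-1 + davg hI t n.+1%:R^-1)%E @[n --> \oo] --> 0%E.
  by rewrite -[X in _ --> X]adde0; apply: cvgeD.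
apply: (le_cvg0_ereal _ _ cRI) => [n|n]; first exact: normc_ge0.
set r := n.+1%:R^-1; have r0 : 0 < r by rewrite invr_gt0 ltr0n.
have r1 : 0 <= (2 * r)^-1 by rewrite invr_ge0 mulr_ge0// ltW.
have bi := cintegrable_flip t (cintegrable_box r0).
have hbi : cintegrable (fun s => h s * (box r (t - s))%:C%C).
  have -> : (fun s => h s * (box r (t - s))%:C%C) = (fun s => (box r (t - s))%:C%C * h s).
    by apply/funext => s; rewrite mulrC.
  apply: (@cintegrable_bounded_mul _ _ _ (2 * r)^-1) => //; first exact: bi.1.
  by move=> s; rewrite normcR ger0_norm ?box_le ?box_ge0.
have -> : convolution h (fun x => (box r x)%:C%C) t - h t =
    cintegral (fun s => (h s - h t) * (box r (t - s))%:C%C).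
  transitivity (cintegral (fun s => h s * (box r (t - s))%:C%C) -
                cintegral (fun s => h t * (box r (t - s))%:C%C)).
    rewrite cintegralZ// (cintegral_flip t (cintegrable_box r0)).
    rewrite cintegralC; last exact: cintegrable_Re (cintegrable_box r0).
    by rewrite /Rintegral integral_box// mulr1.
  rewrite -cintegralB//; last exact: cintegrableZ.
  by apply: eq_cintegral => s; rewrite mulrBl.
have mht : cmeasurable (fun s => h s - h t).
  by apply: cmeasurableD => //; exact: cmeasurable_cst.
apply: (le_trans (le_normc_cintegral _)).
  by apply: cmeasurableM => //; exact: bi.1.
have mB : measurable (ball t r) := measurable_ball _ _.
have -> : (\int[mu]_s (normc ((h s - h t) * (box r (t - s))%:C%C))%:E =
    \int[mu]_(s in ball t r) ((2 * r)^-1%:E * (normc (h s - h t))%:E))%E.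
  rewrite [RHS]integral_mkcond; apply: eq_integral => s _.
  rewrite normcM normcR ger0_norm ?box_ge0// boxE patchE.
  have [ts|ts] := boolP (`|t - s| < r); first by rewrite mem_set// -EFinM mulrC.
  by rewrite memNset ?mulr0//; exact/negP.
have mR : measurable_fun setT (fun s => `|hR s - hR t|).
  by apply: measurableT_comp => //; apply: measurable_funB => //; exact: mh.1.
have mI : measurable_fun setT (fun s => `|hI s - hI t|).
  by apply: measurableT_comp => //; apply: measurable_funB => //; exact: mh.2.
have dE (g : R -> R) : measurable_fun setT (fun s => `|g s - g t|) ->
    davg g t r = (((2 * r)^-1)%:E * \int[mu]_(s in ball t r) `|g s - g t|%:E)%E.
  move=> mg; rewrite /davg /iavg lebesgue_measure_ball ?(ltW r0)//.
  by rewrite inver mulrn_eq0/= gt_eqF// [2 * r]mulr_natl.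
rewrite (dE _ mR) (dE _ mI) -ge0_muleDr ?integral_ge0//.
rewrite ge0_integralZl_EFin//; last 2 first.
- by move=> s _; rewrite lee_fin normc_ge0.
- by apply: measurable_funTS; exact: measurable_normcE.
apply: lee_wpmul2l => //.
rewrite -ge0_integralD//; last 2 first.
- by apply: measurable_funTS; exact/measurable_EFinP.
- by apply: measurable_funTS; exact/measurable_EFinP.
apply: ge0_le_integral => //.
- by move=> s _; rewrite lee_fin normc_ge0.
- by apply: measurable_funTS; exact: measurable_normcE.
- by apply: measurable_funTS; apply: emeasurable_funD; exact/measurable_EFinP.
- move=> s _; rewrite -EFinD lee_fin; apply: (le_trans (normc_le_ReIm _)).
  by rewrite /hR /hI; case: (h s) (h t) => a b [c d].
Qed.

End Averages.

(** * Bounds of a function by its Fourier transform *)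

Section Inversion.
Variable R : realType.
Local Notation mu := (@lebesgue_measure R).
Variable h : R -> R[i].
Hypothesis hi : cintegrable h.

Let b (m : nat) (x : R) : R[i] := (box m.+1%:R^-1 x)%:C%C.
Let k m := convolution h (b m).
Let P (n : nat) (y : R) : R[i] := (poisson n.+1%:R y)%:C%C.

Let r_gt0 m : (0 : R) < m.+1%:R^-1. Proof. by rewrite invr_gt0 ltr0n. Qed.
Let N_gt0 n : (0 : R) < n.+1%:R. Proof. by rewrite ltr0n. Qed.

Let bi m : cintegrable (b m). Proof. exact: cintegrable_box. Qed.
Let ki m : cintegrable (k m). Proof. exact: cintegrable_convolution. Qed.

(** The transform of the average is that of [h] times that of the box, and the latter is at most the
    mass 1 of the box. The bounds below are thereby uniform in [m]. *)
Let fourier_k m x : normc (fourier (k m) x) <= normc (fourier h x).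
Proof.
rewrite fourier_convolution// normcM ler_piMr ?normc_ge0//.
apply: (le_trans (normc_fourier x (bi m))).
under eq_integral do rewrite /b normcR ger0_norm ?box_ge0 ?r_gt0//.
by rewrite integral_box.
Qed.

Let k_cvg m t : normc (convolution (k m) (P n) t) @[n --> \oo] --> normc (k m t).
Proof.
apply: cvg_normc; apply: (cvg_convolution_poisson (ki m).1) => [s|u].
  exact: (normc_convolution_box s (r_gt0 m) hi).
apply: (@cvg_convolution_box _ h _ t (fun n => u / n.+1%:R)) => //.
by rewrite -[X in _ --> X](mulr0 u); apply: cvgM; [exact: cvg_cst|exact: cvg_harmonic].
Qed.

Let mfh : cmeasurable (fourier h). Proof. exact: cmeasurable_fourier hi.1. Qed.
Let mfk m : cmeasurable (fourier (k m)). Proof. exact: cmeasurable_fourier (ki m).1. Qed.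

Let h_cvg : {ae mu, forall t, normc (k m t) @[m --> \oo] --> normc (h t)}.
Proof. by apply: (ae_mono _ (ae_cvg_convolution_box hi)) => t; exact: cvg_normc. Qed.

(** Every Poisson mean of an average is a damped inversion integral, bounded by the right side for
    all [n] and [m]. The limit in [n] holds at each point and the limit in [m] almost everywhere, so
    they are taken in that order. *)
Lemma normc_le_integral_fourier :
  {ae mu, forall t, ((normc (h t))%:E <= \int[mu]_x (normc (fourier h x))%:E)%E}.
Proof.
apply: (ae_mono _ h_cvg) => t ht; apply: (cvg_le_ereal ht) => m.
apply: (cvg_le_ereal (@k_cvg m t)) => n.
have mM : cmeasurable (fun x => fourier (k m) x *
    modulation t (fun y => (abel n.+1%:R y)%:C%C) x).
  apply: cmeasurableM => //; apply: cmeasurableM.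
    apply: cmeasurable_expi; have := measurable_affine (2 * pi * t) 0.
    by under eq_fun do rewrite addr0.
  by apply: cmeasurableR; exact: measurable_abel.
rewrite convolution_poisson//; apply: (le_trans (le_normc_cintegral mM)).
apply: ge0_le_integral => //.
- by move=> x _; rewrite lee_fin normc_ge0.
- exact: measurable_normcE mM.
- exact: measurable_normcE mfh.
move=> x _; rewrite lee_fin !normcM normc_expi mul1r normcR ger0_norm ?expR_ge0//.
by apply: le_trans (fourier_k m x); rewrite ler_piMr ?normc_ge0// abel_le1.
Qed.

Lemma L2_le_fourier :
  (\int[mu]_t ((normc (h t)) ^+ 2)%:E <= \int[mu]_x ((normc (fourier h x)) ^+ 2)%:E)%E.
Proof.
have m2 (g : R -> R[i]) : cmeasurable g -> measurable_fun setT (fun t => normc (g t) ^+ 2).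
  by move=> mg; apply: measurable_funX; exact: measurable_normc.
have sq_cvg (u : nat -> R) (l : R) : u n @[n --> \oo] --> l -> u n ^+ 2 @[n --> \oo] --> l ^+ 2.
  by move=> ul; under eq_fun do rewrite expr2; rewrite expr2; exact: cvgM.
apply: (@fatou_le _ (fun m t => normc (k m t) ^+ 2)).
- by move=> m; apply: m2; exact: (ki m).1.
- by move=> m t; rewrite sqr_ge0.
- exact: m2 hi.1.
- by move=> t; rewrite sqr_ge0.
- by apply: (ae_mono _ h_cvg) => t; exact: sq_cvg.
move=> m; have Pi n : cintegrable (P n) := cintegrable_poisson (N_gt0 n).
apply: (@fatou_le _ (fun n t => normc (convolution (k m) (P n) t) ^+ 2)).
- by move=> n; apply: m2; exact: (cintegrable_convolution (ki m) (Pi n)).1.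
- by move=> n t; rewrite sqr_ge0.
- exact: m2 (ki m).1.
- by move=> t; rewrite sqr_ge0.
- by apply: aeW => t; apply: sq_cvg; exact: k_cvg.
move=> n; pose q x := fourier (k m) x * (abel n.+1%:R x)%:C%C.
have qi : cintegrable q.
  apply: cintegrable_bounded_mul (cintegrable_abel (N_gt0 n)) _ => // x.
  exact: normc_fourier.
(* The damped inversion integral is itself a Fourier transform, of the integrable function [q],
   evaluated at -t. Reflection preserves the L2 norm, so [fourier_L2_le] for [q] bounds the Poisson
   mean by the transform of [k m]: this reverses the direction of the inequality. *)
have cq t : convolution (k m) (P n) t = fourier q (- t).
  rewrite convolution_poisson//; apply: eq_cintegral => x.
  rewrite /q /modulation -[RHS]mulrA; congr (_ * _).
  by rewrite mulrC; congr (_ * expi _); ring.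
under eq_integral do rewrite cq -sub0r.
have mq : measurable_fun setT (fun x => (normc (fourier q x) ^+ 2)%:E).
  by apply/measurable_EFinP; apply: m2; exact: cmeasurable_fourier qi.1.
rewrite (ge0_integral_flip 0 mq); last by move=> x; rewrite lee_fin sqr_ge0.
apply: (le_trans (fourier_L2_le qi)); apply: ge0_le_integral => //.
- by move=> x _; rewrite lee_fin sqr_ge0.
- by apply/measurable_EFinP; apply: m2; exact: qi.1.
- by apply/measurable_EFinP; exact: m2.
move=> x _; rewrite lee_fin ler_pXn2r ?nnegrE ?normc_ge0//.
rewrite normcM normcR ger0_norm ?expR_ge0//.
by apply: le_trans (fourier_k m x); rewrite ler_piMr ?normc_ge0// abel_le1.
Qed.

End Inversion.

(** * Sums over finite subsets *)

Section FiniteSubsets.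

(** Dominated convergence needs a sequence. The sets of elements with code below N are cofinal among
    the finite subsets. *)
Lemma fset_exhaustion (I : countType) : exists E : nat -> {fset I},
  forall A : {fset I}, \forall N \near \oo, (A `<=` E N)%fset.
Proof.
exists (fun N => seq_fset tt (pmap (@choice.unpickle I) (iota 0 N))) => A.
(* One more than the largest code in [A], because [iota 0 N] stops strictly before N. *)
exists (\max_(x <- A) @choice.pickle I x).+1 => // N AN; apply/fsubsetP => x xA.
rewrite seq_fsetE mem_pmap; apply/mapP; exists (@choice.pickle I x); last by rewrite choice.pickleK.
rewrite mem_iota /= add0n (leq_trans _ AN)// ltnS.
by rewrite (big_fsetD1 x)//= leq_maxl.
Qed.

Variable R : realType.
Local Notation mu := (@lebesgue_measure R).

Section Esum.
Variables (I : choiceType) (J : set I) (v : I -> R).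
Hypothesis v0 : forall n, 0 <= v n.

Let fsumE (A : {fset I}) : (\sum_(n <- A | n \in J) v n)%:E =
  (\sum_(n \in [set` A]) (if n \in J then (v n)%:E else 0))%E.
Proof. by rewrite -sumEFin big_mkcond/= fsbig_seq. Qed.

Lemma fset_sum_le_esum (A : {fset I}) :
  ((\sum_(n <- A | n \in J) v n)%:E <= \esum_(n in J) (v n)%:E)%E.
Proof.
by rewrite esum_mkcond fsumE; apply: esum_ge; exists [set` A].
Qed.

Lemma fset_sum_mono (A B : {fset I}) : (A `<=` B)%fset ->
  \sum_(n <- A | n \in J) v n <= \sum_(n <- B | n \in J) v n.
Proof.
move=> AB; rewrite -lee_fin !fsumE; apply: lee_fsum_nneg_subset => //.
  by move=> n /set_mem nA; apply/mem_set; exact: (fsubsetP AB) nA.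
by move=> n _; case: ifP => // _; rewrite lee_fin.
Qed.

Lemma fset_sum_adherent (e : R) : 0 < e ->
  (\esum_(n in J) (v n)%:E < +oo)%E ->
  exists A : {fset I}, fine (\esum_(n in J) (v n)%:E) - e < \sum_(n <- A | n \in J) v n.
Proof.
move=> e0 Eoo; have E0 : (0 <= \esum_(n in J) (v n)%:E)%E.
  by apply: esum_ge0 => n _; rewrite lee_fin.
have Efin : (\esum_(n in J) (v n)%:E)%E \is a fin_num by rewrite ge0_fin_numE.
have [_ [X [finX XJ] <-]] := ub_ereal_sup_adherent e0 Efin.
rewrite fsbig_finite// => h; exists (fset_set X).
rewrite -lte_fin EFinB fineK//; apply: (lt_le_trans h).
rewrite -sumEFin [X in (_ <= X)%E]big_seq_cond [X in (X <= _)%E]big_seq_cond.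
rewrite le_eqVlt; apply/orP; left; apply/eqP; apply: eq_bigl => n.
rewrite andbT; have [nX|//] := boolP (n \in fset_set X).
by rewrite mem_set//; apply: XJ; move: nX; rewrite in_fset_set// inE.
Qed.

End Esum.

(** Along the exhaustion the partial sums tend to 1 almost everywhere, by monotonicity and the third
    clause, so dominated convergence with majorant [F] yields one set [E N] of error at most [e].
    Every larger finite set has a pointwise smaller error, again by monotonicity, which is
    convergence along the filter. *)
Lemma cvg_integral_fset_sum (I : countType) (J : set I) (w : I -> R -> R) (F : R -> R)
    (e : R) :
  let s (A : {fset I}) x := \sum_(n <- A | n \in J) w n x in
  (forall n, J n -> measurable_fun setT (w n)) ->
  measurable_fun setT F -> (forall x, 0 <= F x) -> (\int[mu]_x (F x)%:E < +oo)%E ->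
  {ae mu, forall x, [/\ forall A, 0 <= s A x <= 1,
     (forall A B : {fset I}, (A `<=` B)%fset -> s A x <= s B x) &
     forall d, 0 < d -> exists A, 1 - d < s A x]} ->
  0 < e -> \forall A \near @finite_subsets I,
    (\int[mu]_x (F x * `|1 - s A x|)%:E <= e%:E)%E.
Proof.
move=> s mw mF F0 Foo good e0.
have ms A : measurable_fun setT (s A).
  rewrite /s; elim: (A : seq I) => [|n r IH].
    by under eq_fun do rewrite big_nil; exact: measurable_cst.
  have [nJ|nJ] := boolP (n \in J); last by under eq_fun do rewrite big_cons (negbTE nJ).
  under eq_fun do rewrite big_cons nJ.
  by apply: measurable_funD => //; apply: mw; exact: set_mem.
have mFs A : measurable_fun setT (fun x => F x * `|1 - s A x|).
  apply: measurable_funM => //; apply: measurableT_comp => //.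
  by apply: measurable_funB.
have [E hE] := fset_exhaustion I.
have iF : mu.-integrable setT (EFin \o F).
  apply/integrableP; split; first exact/measurable_EFinP.
  by under eq_integral do rewrite gee0_abs ?lee_fin//.
have [_ _ cv] : [/\ mu.-integrable setT (fun=> 0%E : \bar R),
    [sequence \int[mu]_x `|(F x * `|1 - s (E n) x|)%:E - 0|]_n @ \oo --> 0%E &
    [sequence \int[mu]_x (F x * `|1 - s (E n) x|)%:E]_n @ \oo -->
    (\int[mu]_(x in setT) 0%E)%E]%E.
  apply: (dominated_convergence measurableT _ _ _ iF).
  - by move=> n; apply/measurable_EFinP; exact: mFs.
  - exact: measurable_cst.
  - apply: (ae_mono _ good) => x [s01 smono sadh] _.
    apply/fine_cvgP; split; first exact: nearW.
    have h : `|1 - s (E n) x| @[n --> \oo] --> (0 : R).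
      apply/cvgr0Pnorm_le => d d0; have [A hA] := sadh _ d0.
      have := hE A; apply: filterS => n /smono An.
      by rewrite normr_id ger0_norm ?subr_ge0 ?(andP (s01 _)).2//; lra.
    have : F x * `|1 - s (E n) x| @[n --> \oo] --> F x * 0.
      by apply: cvgM => //; exact: cvg_cst.
    by rewrite mulr0.
  - apply: (ae_mono _ good) => x [s01 _ _] n _.
    rewrite gee0_abs ?lee_fin ?mulr_ge0// ler_piMr//.
    by have /andP[? ?] := s01 (E n); rewrite ger0_norm; lra.
rewrite integral0 in cv.
have /fine_cvgP[cfin /cvgr0Pnorm_le/(_ _ e0) ce] := cv.
near \oo => N.
exists (E N) => // A /= EA.
have Nfin : (\int[mu]_x (F x * `|1 - s (E N) x|)%:E)%E \is a fin_num by near: N.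
have Ne : `|fine (\int[mu]_x (F x * `|1 - s (E N) x|)%:E)%E| <= e by near: N.
apply: (@le_trans _ _ (\int[mu]_x (F x * `|1 - s (E N) x|)%:E)%E).
  apply: ae_ge0_le_integral => //.
  - by move=> x _; rewrite lee_fin mulr_ge0.
  - by apply/measurable_EFinP; exact: mFs.
  - by move=> x _; rewrite lee_fin mulr_ge0.
  - by apply/measurable_EFinP; exact: mFs.
  - apply: (ae_mono _ good) => x [s01 smono _] _; rewrite lee_fin ler_wpM2l//.
    have /andP[? ?] := s01 (E N); have /andP[? ?] := s01 A.
    by have := smono _ _ EA => ?; rewrite !ger0_norm; lra.
by rewrite -(fineK Nfin) lee_fin (le_trans (ler_norm _)).
Unshelve. all: by end_near. Qed.

End FiniteSubsets.

(** * L2 norms as integrals of squares *)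

Section L2.
Variable R : realType.
Local Notation mu := (@lebesgue_measure R).

Lemma Lnorm2_normc (g : R -> R[i]) :
  Lnorm mu 2%:E (fun t => (normc (g t))%:E) =
  ((\int[mu]_t (normc (g t) ^+ 2)%:E) `^ 2^-1)%E.
Proof.
rewrite unlock /=; congr poweR; apply: eq_integral => t _.
by rewrite ger0_norm ?normc_ge0// powR_mulrn ?normc_ge0.
Qed.

Lemma in_L2_integral (g : R -> R[i]) : in_Lp 2%:E g ->
  (\int[mu]_t (normc (g t) ^+ 2)%:E < +oo)%E.
Proof.
by move=> [_ _]; rewrite Lnorm2_normc; apply: lty_poweRy; rewrite invr_eq0 pnatr_eq0.
Qed.

Lemma Lnorm2_le (g : R -> R[i]) (e : R) : 0 <= e ->
  (\int[mu]_t (normc (g t) ^+ 2)%:E <= (e ^+ 2)%:E)%E ->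
  (Lnorm mu 2%:E (fun t => (normc (g t))%:E) <= e%:E)%E.
Proof.
move=> e0 h; rewrite Lnorm2_normc.
have -> : e%:E = ((e ^+ 2)%:E `^ 2^-1)%E.
  by rewrite poweR_EFin -powR_mulrn// -powRrM mulfV ?powRr1// pnatr_eq0.
apply: gt0_ler_poweR => //.
- rewrite in_itv/= leey andbT; apply: integral_ge0 => t _.
  by rewrite lee_fin sqr_ge0.
- by rewrite in_itv/= leey andbT lee_fin sqr_ge0.
Qed.

End L2.

(** * Reconstruction from the empirical wavelet transform *)

Section Reconstruction.
Variables (R : realType) (P : freq_partition R) (a : int -> R).
Variables (psi : R -> R[i]) (phi : int -> R -> R[i]) (f : R -> R[i]).
Local Notation mu := (@lebesgue_measure R).
Local Notation J := (indices P).
Local Notation S := (wavelet_energy P a psi).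
Local Notation psih := (wavelet_hat P a psi).
Hypothesis a_gt0 : forall n, J n -> 0 < a n.
Hypothesis psii : cintegrable psi.
Hypothesis energy_ae : {ae mu, forall xi, (0 < S xi < +oo)%E}.
Hypothesis phii : forall n, J n -> cintegrable (phi n).
Hypothesis phi_dual : forall n, J n -> forall xi, (0 < S xi < +oo)%E ->
  fourier (phi n) xi = psih n xi / (fine (S xi))%:C%C.
Hypothesis fi : cintegrable f.

(** The untranslated wavelet: [empirical_wavelet P a psi b n] is [translation b (psin n)], and
    [wavelet_hat] is its transform. *)
Let psin n := modulation (support_center P n) (dilation (a n)^-1 psi).

Let psini n : J n -> cintegrable (psin n).
Proof.
move=> Jn; have an := a_gt0 Jn; have an0 : a n != 0 by rewrite gt_eqF.
have di : cintegrable (dilation (a n)^-1 psi).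
  apply: cintegrableZ; have := cintegrable_affine 0 an0 psii.
  by under eq_fun do rewrite addr0 mulrC -[X in _ * X]invrK.
have m : measurable_fun setT (fun t : R => 2 * pi * support_center P n * t).
  have := measurable_affine (2 * pi * support_center P n) 0.
  by under eq_fun do rewrite addr0.
have := cintegrableMexpi m di.
by under eq_fun do rewrite mulrC.
Qed.

Let fourier_psin n x : J n -> fourier (psin n) x = psih n x.
Proof. by move=> Jn; rewrite fourier_modulation fourier_dilation//; exact: a_gt0. Qed.

Let G n := (empirical_transform P a psi f)^~ n.

Let GE n : G n = convolution f (fun s => (psin n (- s))^*).
Proof.
apply/funext => b; apply: eq_cintegral => t.
by rewrite /empirical_wavelet /translation opprB.
Qed.

Let flipi n : J n -> cintegrable (fun s => (psin n (- s))^*).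
Proof.
move=> Jn; apply: cintegrableJ; have := cintegrable_flip 0 (psini Jn).
by under eq_fun do rewrite sub0r.
Qed.

Let Gi n : J n -> cintegrable (G n).
Proof. by move=> Jn; rewrite GE; apply: cintegrable_convolution => //; exact: flipi. Qed.

Let C n := convolution (G n) (phi n).

Let Ci n : J n -> cintegrable (C n).
Proof. by move=> Jn; apply: cintegrable_convolution; [exact: Gi|exact: phii]. Qed.

(** This is |psih|^2 divided by the energy wherever the energy is positive and finite. In this form
    measurability is immediate for [n] in [J], both factors being transforms of integrable
    functions, whereas the quotient would call for measurability of the energy. *)
Let w n x : R := complex.Re ((psih n x)^* * fourier (phi n) x).

Let mpsih n : J n -> cmeasurable (psih n).
Proof.
move=> Jn; have -> : psih n = fourier (psin n).
  by apply/funext => x; rewrite fourier_psin.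
exact: cmeasurable_fourier (psini Jn).1.
Qed.

Let mw n : J n -> measurable_fun setT (w n).
Proof.
move=> Jn; have mpn := mpsih Jn.
have mphin := cmeasurable_fourier (phii Jn).1.
by have [] := cmeasurableM (cmeasurableJ mpn) mphin.
Qed.

Let wE n x : J n -> (0 < S x < +oo)%E -> w n x = normc (psih n x) ^+ 2 / fine (S x).
Proof.
move=> Jn Sx; rewrite /w phi_dual// mulrA [_^* * _]mulrC mulcJ.
by rewrite -fmorphV -rmorphM.
Qed.

Let fourier_C n x : J n -> (0 < S x < +oo)%E ->
  fourier (C n) x = fourier f x * (w n x)%:C%C.
Proof.
move=> Jn Sx; rewrite fourier_convolution; [|exact: Gi|exact: phii].
rewrite GE fourier_convolution//; last exact: flipi.
rewrite fourier_flipJ; last exact: psini.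
rewrite fourier_psin// -mulrA; congr (_ * _).
by rewrite wE// phi_dual// mulrA [_^* * _]mulrC mulcJ -fmorphV -rmorphM.
Qed.

Let s (A : {fset int}) x : R := \sum_(n <- A | n \in J) w n x.

Let h (A : {fset int}) t := f t - \sum_(n <- A | n \in J) C n t.

Let inJ n : n \in J -> J n. Proof. exact: set_mem. Qed.

Let sCi A : cintegrable (fun t => \sum_(n <- A | n \in J) C n t).
Proof. by apply: cintegrable_sum => n /inJ; exact: Ci. Qed.

Let hi A : cintegrable (h A).
Proof.
have := cintegrableD fi (cintegrableZ (- 1) (sCi A)).
by under eq_fun do rewrite mulN1r.
Qed.

Let fourier_h A x : (0 < S x < +oo)%E ->
  fourier (h A) x = fourier f x * (1 - s A x)%:C%C.
Proof.
move=> Sx; have -> : h A = (fun t => f t + (- 1) * \sum_(n <- A | n \in J) C n t).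
  by apply/funext => t; rewrite mulN1r.
rewrite fourierD//; last exact/cintegrableZ/sCi.
rewrite fourierZ// fourier_sum; last by move=> n /inJ; exact: Ci.
rewrite mulN1r rmorphB rmorph1 mulrBr mulr1; congr (_ - _).
rewrite /s rmorph_sum mulr_sumr; apply: eq_bigr => n /inJ Jn.
exact: fourier_C.
Qed.

(** Where the energy is positive and finite, these are finite sums of nonnegative terms divided by
    their supremum, which is how [\esum] is defined; the three clauses express just that. *)
Let good : {ae mu, forall x, [/\ forall A, 0 <= s A x <= 1,
     (forall A B : {fset int}, (A `<=` B)%fset -> s A x <= s B x) &
     forall d, 0 < d -> exists A, 1 - d < s A x]}.
Proof.
apply: (ae_mono _ energy_ae) => x Sx.
pose v n := normc (psih n x) ^+ 2.
have v0 n : 0 <= v n by rewrite sqr_ge0.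
have S_fin : S x \is a fin_num by have /andP[/ltW ? ?] := Sx; rewrite ge0_fin_numE.
have S0 : 0 < fine (S x) by rewrite fine_gt0.
have sE A : s A x = (\sum_(n <- A | n \in J) v n) / fine (S x).
  by rewrite mulr_suml; apply: eq_bigr => n /inJ Jn; exact: wE.
split=> [A|A B AB|d d0]; rewrite ?sE.
- rewrite divr_ge0 ?sumr_ge0 ?(ltW S0)//= ler_pdivrMr// mul1r -lee_fin fineK//.
  exact: fset_sum_le_esum.
- by rewrite ler_pM2r ?invr_gt0//; exact: fset_sum_mono.
(* The tolerance is [d] times the energy, so that it becomes [d] after division by the energy. *)
have [A hA] := fset_sum_adherent v0 (mulr_gt0 d0 S0) (proj2 (andP Sx)).
exists A; rewrite sE ltr_pdivlMr// mulrBl mul1r; exact: hA.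
Qed.

Let mfh : cmeasurable (fourier f). Proof. exact: cmeasurable_fourier fi.1. Qed.

Let normc_fourier_h A x : (0 < S x < +oo)%E ->
  normc (fourier (h A) x) = normc (fourier f x) * `|1 - s A x|.
Proof. by move=> Sx; rewrite fourier_h// normcM normcR. Qed.

Let ms A : measurable_fun setT (s A).
Proof.
rewrite /s; elim: (A : seq int) => [|n r IH].
  by under eq_fun do rewrite big_nil; exact: measurable_cst.
have [nJ|nJ] := boolP (n \in J); last by under eq_fun do rewrite big_cons (negbTE nJ).
under eq_fun do rewrite big_cons nJ.
by apply: measurable_funD => //; apply: mw; exact: set_mem.
Qed.

Let mds A : measurable_fun setT (fun x => `|1 - s A x|).
Proof.
apply: measurableT_comp => //; apply: measurable_funB; last exact: ms.
exact: measurable_cst.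
Qed.

Lemma reconstruction_L2 : (\int[mu]_t (normc (f t) ^+ 2)%:E < +oo)%E ->
  has_L2_sum J C f.
Proof.
move=> f2.
pose F x := normc (fourier f x) ^+ 2.
have mF : measurable_fun setT F by apply: measurable_funX; exact: measurable_normc.
have F0 x : 0 <= F x by rewrite sqr_ge0.
have Foo : (\int[mu]_x (F x)%:E < +oo)%E := le_lt_trans (fourier_L2_le fi) f2.
have key e : 0 < e -> \forall A \near @finite_subsets int,
    (Lnorm mu 2%:E (fun t => (normc (h A t))%:E) <= e%:E)%E.
  (* The tolerance is e^2 because the integral bounds the square of the L2 norm. *)
  move=> e0; have := cvg_integral_fset_sum mw mF F0 Foo good (exprn_gt0 2 e0).
  apply: filterS => A hA; apply: Lnorm2_le; first exact: ltW.
  apply: le_trans (L2_le_fourier (hi A)) _; apply: le_trans hA.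
  apply: ae_ge0_le_integral => //.
  - by move=> x _; rewrite lee_fin sqr_ge0.
  - apply/measurable_EFinP; apply: measurable_funX; apply: measurable_normc.
    exact: cmeasurable_fourier (hi A).1.
  - by move=> x _; rewrite lee_fin mulr_ge0.
  - apply/measurable_EFinP; apply: measurable_funM => //.
    exact: mds.
  apply: (ae_mono _ (ae_and energy_ae good)) => x [Sx [s01 _ _]] _.
  rewrite lee_fin normc_fourier_h// exprMn; apply: ler_wpM2l; first exact: F0.
  (* The missing weight [|1 - s A x|] lies in [0, 1], so its square is at most itself; the weighted
     integral then has the same form as in the pointwise case. *)
  rewrite expr2 ler_piMl//.
  by have /andP[? ?] := s01 A; rewrite ger0_norm; lra.
apply/fine_cvgP; split.
  have := key 1 ltr01; apply: filterS => A hA.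
  by rewrite ge0_fin_numE ?Lnorm_ge0// (le_lt_trans hA)// ltry.
apply/cvgr0Pnorm_le => e e0; have := key e e0; apply: filterS => A hA.
have L0 : (0 <= Lnorm mu 2%:E (fun t => (normc (h A t))%:E))%E := Lnorm_ge0 _ _ _.
rewrite ger0_norm ?fine_ge0// -lee_fin fineK//.
by rewrite ge0_fin_numE// (le_lt_trans hA)// ltry.
Qed.

Lemma reconstruction_ae : cintegrable (fourier f) ->
  {ae mu, forall t, has_sum J (fun n => C n t) (f t)}.
Proof.
move=> fhi.
pose F x := normc (fourier f x).
have mF : measurable_fun setT F by exact: measurable_normc.
have F0 x : 0 <= F x by rewrite normc_ge0.
have Foo : (\int[mu]_x (F x)%:E < +oo)%E := fhi.2.
have hb A : {ae mu, forall t,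
    ((normc (h A t))%:E <= \int[mu]_x (F x * `|1 - s A x|)%:E)%E}.
  apply: (ae_mono _ (normc_le_integral_fourier (hi A))) => t ht.
  apply: le_trans ht _; apply: ae_ge0_le_integral => //.
  - by move=> x _; rewrite lee_fin normc_ge0.
  - by apply: measurable_normcE; exact: cmeasurable_fourier (hi A).1.
  - by move=> x _; rewrite lee_fin mulr_ge0.
  - apply/measurable_EFinP; apply: measurable_funM => //.
    exact: mds.
  by apply: (ae_mono _ energy_ae) => x Sx _; rewrite normc_fourier_h.
(* The null set in [hb] depends on [A]. Finite sets of integers are countably many, so quantifying
   over their codes gives one null set valid for all of them. *)
have hb_all : {ae mu, forall t, forall k : nat, forall A,
    @choice.unpickle {fset int} k = Some A ->
    ((normc (h A t))%:E <= \int[mu]_x (F x * `|1 - s A x|)%:E)%E}.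
  apply: ae_foralln => k; case: (choice.unpickle k) => [A|]; last exact: aeW.
  by apply: (ae_mono _ (hb A)) => t ht B [<-].
apply: (ae_mono _ hb_all) => t ht; apply/cvgr0Pnorm_le => e e0.
have := cvg_integral_fset_sum mw mF F0 Foo good e0; apply: filterS => A hA.
rewrite ger0_norm ?normc_ge0// -lee_fin; apply: le_trans hA.
exact: ht (choice.pickleK A).
Qed.

End Reconstruction.

(** The series is read in two ways because the error is controlled in two ways: its L2 norm by that
    of its transform, for every [f], and its pointwise size by the integral of |f^| times the
    missing weight, where |f^| has to be an integrable majorant. Both sums are unconditional, so no
    ordering of the indices is involved. The formula for the dual is imposed where its denominator
    is positive and finite. *)
Theorem proposition2 (R : realType) (P : freq_partition R) (a : int -> R)
    (psi : R -> R[i]) (phi : int -> R -> R[i]) (f : R -> R[i])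
    (a_gt0 : forall n, indices P n -> 0 < a n)
    (psi_L1L2 : in_L1L2 psi)
    (energy_ae : {ae @lebesgue_measure R, forall xi,
       (0 < wavelet_energy P a psi xi < +oo)%E})
    (phi_L1L2 : forall n, indices P n -> in_L1L2 (phi n))
    (phi_dual : forall n, indices P n -> forall xi,
       (0 < wavelet_energy P a psi xi < +oo)%E ->
       fourier (phi n) xi =
         wavelet_hat P a psi n xi / (fine (wavelet_energy P a psi xi))%:C%C)
    (f_L1L2 : in_L1L2 f) :
  has_L2_sum (indices P)
    (fun n => convolution ((empirical_transform P a psi f)^~ n) (phi n)) f
  /\ (in_Lp 1%E (fourier f) ->
      {ae @lebesgue_measure R, forall t,
        has_sum (indices P)
          (fun n => convolution ((empirical_transform P a psi f)^~ n) (phi n) t)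
          (f t)}).
Proof.
have fi := (in_Lp1P f).1 f_L1L2.1.
have psii := (in_Lp1P psi).1 psi_L1L2.1.
have phii n (Jn : indices P n) := (in_Lp1P (phi n)).1 (phi_L1L2 n Jn).1.
split; first exact: (reconstruction_L2 a_gt0 psii energy_ae phii phi_dual fi
  (in_L2_integral f_L1L2.2)).
move=> /in_Lp1P.
exact: (reconstruction_ae a_gt0 psii energy_ae phii phi_dual fi).
Qed.
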